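(* Suppose $0\le i\le n$, $a\in\mathbb{N}$ and $\ell\in\mathbb{N}_+$. Then, as differential operators from forms on $\mathbb{R}^n$ to forms on $\mathbb{R}^{n-1}$, (1) $\displaystyle\mathcal{D}^{i\to i-1}_{\frac n2-i+\ell,a}\circ\mathcal{T}^{(i)}_{2\ell}=-\Big(\frac n2-i-\ell\Big)K_{\ell,a}\,\mathcal{D}^{i\to i-1}_{\frac n2-i-\ell,a+2\ell}$ if $i\neq0$; (2) $\displaystyle\mathcal{D}^{i\to i}_{\frac n2-i+\ell,a}\circ\mathcal{T}^{(i)}_{2\ell}=-\Big(\frac n2-i+\ell\Big)K_{\ell,a}\,\mathcal{D}^{i\to i}_{\frac n2-i-\ell,a+2\ell}$ if $i\neq n$.
   Context: $n\ge2$; $\mathbb{N}=\{0,1,2,\dots\}$, $\mathbb{N}_+=\{1,2,\dots\}$; $\mathcal{E}^i$: smooth complex-valued $i$-forms. $K_{\ell,a}=\prod_{k=1}^{\ell}\big([\frac a2]+k\big)$. Branson's operator on $\mathcal{E}^i(\mathbb{R}^n)$: $$\mathcal{T}^{(i)}_{2\ell}=\Big(\big(\tfrac n2-i-\ell\big)d_{\mathbb{R}^n}d^*_{\mathbb{R}^n}+\big(\tfrac n2-i+\ell\big)d^*_{\mathbb{R}^n}d_{\mathbb{R}^n}\Big)\Delta_{\mathbb{R}^n}^{\ell-1},$$ where $d^*$ is the formal adjoint of $d$ for the flat metric and $\Delta_{\mathbb{R}^n}=-(dd^*+d^*d)=\sum_{j=1}^n\partial^2/\partial x_j^2$ coefficientwise.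 $\mathbb{R}^{n-1}=\{x_n=0\}\subset\mathbb{R}^n$, $\mathrm{Rest}_{x_n=0}$ is pull-back of forms, $\iota_{\partial/\partial x_n}$ interior multiplication, $\Delta_{\mathbb{R}^{n-1}}=\sum_{j=1}^{n-1}\partial^2/\partial x_j^2$. For $\mu\in\mathbb{C}$, $b\in\mathbb{N}$, $$\mathcal{D}^\mu_b=\sum_{k=0}^{[b/2]}\frac{2^{b-2k}}{k!(b-2k)!}\Big(\prod_{m=[(b+1)/2]}^{b-k-1}(\mu+m)\Big)\Delta_{\mathbb{R}^{n-1}}^k\Big(\frac{\partial}{\partial x_n}\Big)^{b-2k}$$ (empty product $=1$), acting coefficientwise, and $\mathcal{D}^\mu_b=0$ for $b<0$. $\gamma(\mu,a)=1$ for $a$ odd, $=\mu+\frac a2$ for $a$ even. With $\mu:=u+i-\frac{n-1}2$, the operators $\mathcal{D}^{i\to i-1}_{u,a}:\mathcal{E}^i(\mathbb{R}^n)\to\mathcal{E}^{i-1}(\mathbb{R}^{n-1})$ ($1\le i\le n$) and $\mathcal{D}^{i\to i}_{u,a}:\mathcal{E}^i(\mathbb{R}^n)\to\mathcal{E}^{i}(\mathbb{R}^{n-1})$ ($0\le i\le n-1$) are $$\mathcal{D}^{i\to i-1}_{u,a}=\mathrm{Rest}_{x_n=0}\circ\Big(-\mathcal{D}^{\mu+1}_{a-2}dd^*\iota_{\frac{\partial}{\partial x_n}}-\gamma(\mu,a)\mathcal{D}^{\mu+1}_{a-1}d^*+\tfrac12(u+2i-n)\mathcal{D}^\mu_a\iota_{\frac{\partial}{\partial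 x_n}}\Big),$$ $$\mathcal{D}^{i\to i}_{u,a}=\mathrm{Rest}_{x_n=0}\circ\Big(\mathcal{D}^{\mu+1}_{a-2}dd^*-\gamma(\mu-\tfrac12,a)\mathcal{D}^{\mu}_{a-1}d\,\iota_{\frac{\partial}{\partial x_n}}+\tfrac12(u+a)\mathcal{D}^\mu_a\Big),$$ with $d,d^*$ on $\mathbb{R}^n$. *)

(* Defs.v *)
From HB Require Import structures.
From mathcomp Require Import all_boot all_order all_algebra.
From mathcomp Require Import complex ring.
From mathcomp Require Import all_classical all_reals all_analysis.

Set Implicit Arguments.
Unset Strict Implicit.
Unset Printing Implicit Defensive.

Import Order.TTheory GRing.Theory Num.Theory.
Import numFieldNormedType.Exports.

Local Open Scope ring_scope.

(* Complex-valued functions are differentiated through their real and imaginary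
   parts.  The coordinates of 'rV[R]_n are indexed by 0, ..., n-1, so x_n is
   the coordinate ord_max of 'rV[R]_m.+1 when n = m.+1. *)

Definition basis_vec (R : realType) (n : nat) (j : 'I_n) : 'rV[R]_n :=
  delta_mx 0 j.

Definition rpartial (R : realType) (n : nat) (j : 'I_n) (f : 'rV[R]_n -> R) :
    'rV[R]_n -> R :=
  fun x => 'D_(basis_vec R j) f x.

Definition partial (R : realType) (n : nat) (j : 'I_n)
    (f : 'rV[R]_n -> R[i]) : 'rV[R]_n -> R[i] :=
  fun x => (rpartial j (fun y => complex.Re (f y)) x
            +i* rpartial j (fun y => complex.Im (f y)) x)%C.

Definition rsmooth (R : realType) (n : nat) (f : 'rV[R]_n -> R) : Prop :=
  forall s : seq 'I_n,
    let g := foldr (@rpartial R n) f s in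
    continuous g /\ forall (j : 'I_n) x, derivable g x (basis_vec R j).

Definition smooth (R : realType) (n : nat) (f : 'rV[R]_n -> R[i]) : Prop :=
  rsmooth (fun x => complex.Re (f x)) /\ rsmooth (fun x => complex.Im (f x)).

(* w : diff_form R n stands for \sum_I (w I) dx_I, where I ranges over the
   subsets of the coordinates and dx_I is the wedge product of the dx_k,
   k \in I, taken in increasing order of k. *)
Definition diff_form (R : realType) (n : nat) : Type :=
  {set 'I_n} -> 'rV[R]_n -> R[i].

(* The space E^i(R^n) of smooth complex-valued i-forms. *)
Definition is_form (R : realType) (n i : nat) (w : diff_form R n) : Prop :=
  (forall I, smooth (w I)) /\
  (forall (I : {set 'I_n}) x, #|I| != i -> w I x = 0).

Definition fadd (R : realType) (n : nat) (w1 w2 : diff_form R n) :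
    diff_form R n :=
  fun I x => w1 I x + w2 I x.

Definition fscale (R : realType) (n : nat) (c : R[i]) (w : diff_form R n) :
    diff_form R n :=
  fun I x => c * w I x.

(* dx_j /\ dx_I = wedge_sign j I dx_(j |: I) for j \notin I. *)
Definition wedge_sign (R : realType) (n : nat) (j : 'I_n) (I : {set 'I_n}) :
    R[i] :=
  (-1) ^+ #|[set k in I | (k < j)%N]|.

(* The first-order operator \sum_j A_j \partial_j with constant coefficients,
   where A_j is the matrix (A j J I)_(J, I) in the basis (dx_I)_I. *)
Definition diffop1 (R : realType) (n : nat)
    (A : 'I_n -> {set 'I_n} -> {set 'I_n} -> R[i]) (w : diff_form R n) :
    diff_form R n :=
  fun J x => \sum_(j < n) \sum_(I : {set 'I_n}) A j J I * partial j (w I) x.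

(* The formal adjoint of \sum_j A_j \partial_j is - \sum_j A_j^* \partial_j,
   A_j^* being the conjugate transpose: for the flat metric the dx_I are
   orthonormal.  See formal_adjoint1P. *)
Definition formal_adjoint1 (R : realType) (n : nat)
    (A : 'I_n -> {set 'I_n} -> {set 'I_n} -> R[i]) :
    'I_n -> {set 'I_n} -> {set 'I_n} -> R[i] :=
  fun j I J => - (A j J I)^*.

(* The matrix of dx_j /\ _ , so that d = \sum_j dx_j /\ \partial_j. *)
Definition wedge_mx (R : realType) (n : nat) (j : 'I_n) (J I : {set 'I_n}) :
    R[i] :=
  if (j \notin I) && (J == j |: I) then wedge_sign R j I else 0.

Definition ext_d (R : realType) (n : nat) : diff_form R n -> diff_form R n :=
  diffop1 (@wedge_mx R n).

Definition codifferential (R : realType) (n : nat) :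
    diff_form R n -> diff_form R n :=
  diffop1 (formal_adjoint1 (@wedge_mx R n)).

Definition hodge_laplacian (R : realType) (n : nat) (w : diff_form R n) :
    diff_form R n :=
  fscale (-1) (fadd (ext_d (codifferential w)) (codifferential (ext_d w))).

(* Interior multiplication by \partial / \partial x_j. *)
Definition interior_mult (R : realType) (n : nat) (j : 'I_n)
    (w : diff_form R n) : diff_form R n :=
  fun I x => if j \in I then 0 else wedge_sign R j I * w (j |: I) x.

(* The inclusion R^m = {x_(m+1) = 0} -> R^(m+1). *)
Definition hyperplane_incl (R : realType) (m : nat) (x : 'rV[R]_m) :
    'rV[R]_m.+1 :=
  \row_(j < m.+1) oapp (x 0) 0 (unlift ord_max j).

(* Pull-back by hyperplane_incl, which sends dx_(m+1) to 0 and every other dx_j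
   to dx_j. *)
Definition Rest (R : realType) (m : nat) (w : diff_form R m.+1) :
    diff_form R m :=
  fun I x => w (lift ord_max @: I) (hyperplane_incl x).

(* Branson's operator T_(2l)^(i), for l >= 1. *)
Definition branson (R : realType) (n i l : nat) (w : diff_form R n) :
    diff_form R n :=
  let v := iter l.-1 (@hodge_laplacian R n) w in
  fadd (fscale (n%:R / 2 - i%:R - l%:R) (ext_d (codifferential v)))
       (fscale (n%:R / 2 - i%:R + l%:R) (codifferential (ext_d v))).

(* The Laplacian of R^m, acting on functions on R^(m+1). *)
Definition tangential_laplacian (R : realType) (m : nat)
    (f : 'rV[R]_m.+1 -> R[i]) : 'rV[R]_m.+1 -> R[i] :=
  fun x => \sum_(j < m)
    partial (lift ord_max j) (partial (lift ord_max j) f) x.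

Definition juhl_nat (R : realType) (m : nat) (mu : R[i]) (b : nat)
    (f : 'rV[R]_m.+1 -> R[i]) : 'rV[R]_m.+1 -> R[i] :=
  fun x => \sum_(0 <= k < b./2.+1)
    (2 ^+ (b - 2 * k) / (k`! * (b - 2 * k)`!)%N%:R)
    * (\prod_((b.+1)./2 <= p < b - k) (mu + p%:R))
    * iter k (@tangential_laplacian R m)
        (iter (b - 2 * k) (partial ord_max) f) x.

(* D^mu_b, acting coefficientwise. *)
Definition juhl (R : realType) (m : nat) (mu : R[i]) (b : int)
    (w : diff_form R m.+1) : diff_form R m.+1 :=
  match b with
  | Posz b' => fun I => juhl_nat mu b' (w I)
  | Negz _ => fun _ _ => 0
  end.

Definition gamma_coef (R : realType) (mu : R[i]) (a : nat) : R[i] :=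
  if odd a then 1 else mu + a%:R / 2.

Definition K_coef (l a : nat) : nat :=
  (\prod_(1 <= k < l.+1) (a./2 + k))%N.

(* mu = u + i - (n-1)/2 with n = m.+1. *)
Definition mu_of (R : realType) (m i : nat) (u : R[i]) : R[i] :=
  u + i%:R - m%:R / 2.

(* D_(u,a)^(i -> i-1). *)
Definition sbo_down (R : realType) (m i : nat) (u : R[i]) (a : nat)
    (w : diff_form R m.+1) : diff_form R m :=
  let mu := mu_of m i u in
  let iw := interior_mult ord_max w in
  Rest
    (fadd (fscale (-1) (juhl (mu + 1) (a%:Z - 2) (ext_d (codifferential iw))))
    (fadd (fscale (- gamma_coef mu a)
             (juhl (mu + 1) (a%:Z - 1) (codifferential w)))
          (fscale ((u + 2 * i%:R - m.+1%:R) / 2) (juhl mu a%:Z iw)))).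

(* D_(u,a)^(i -> i). *)
Definition sbo_same (R : realType) (m i : nat) (u : R[i]) (a : nat)
    (w : diff_form R m.+1) : diff_form R m :=
  let mu := mu_of m i u in
  Rest
    (fadd (juhl (mu + 1) (a%:Z - 2) (ext_d (codifferential w)))
    (fadd (fscale (- gamma_coef (mu - 1 / 2) a)
             (juhl mu (a%:Z - 1) (ext_d (interior_mult ord_max w))))
          (fscale ((u + a%:R) / 2) (juhl mu a%:Z w)))).

Section FormalAdjoint.

Let cderivable (R : realType) (n : nat) (j : 'I_n) (f : 'rV[R]_n -> R[i]) x :=
  derivable (fun y => complex.Re (f y)) x (basis_vec R j) /\
  derivable (fun y => complex.Im (f y)) x (basis_vec R j).

Lemma smooth_cderivable (R : realType) (n : nat) (f : 'rV[R]_n -> R[i]) j x :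
  smooth f -> cderivable j f x.
Proof. by move=> [fr fi]; split; [exact: (fr [::]).2 | exact: (fi [::]).2]. Qed.

Lemma partialM (R : realType) (n : nat) (f g : 'rV[R]_n -> R[i]) j x :
  cderivable j f x -> cderivable j g x ->
  cderivable j (fun y => f y * g y) x /\
  partial j (fun y => f y * g y) x = partial j f x * g x + f x * partial j g x.
Proof.
move=> [fr fi] [gr gi].
pose a y := complex.Re (f y); pose b y := complex.Im (f y).
pose c y := complex.Re (g y); pose e y := complex.Im (g y).
have Er : (fun y => complex.Re (f y * g y)) = a * c - b * e.
  by apply/funext => y; rewrite /a /b /c /e !fctE; case: (f y); case: (g y).
have Ei : (fun y => complex.Im (f y * g y)) = a * e + b * c.
  by apply/funext => y; rewrite /a /b /c /e !fctE; case: (f y); case: (g y).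
have [ac be] := (derivableM fr gr, derivableM fi gi).
have [ae bc] := (derivableM fr gi, derivableM fi gr).
split.
  rewrite /cderivable Er Ei.
  by split; [apply: (derivableB ac be) | apply: (derivableD ae bc)].
rewrite /partial /rpartial Er Ei (deriveB ac be) (deriveD ae bc).
rewrite (deriveM fr gr) (deriveM fi gi) (deriveM fr gi) (deriveM fi gr).
rewrite -/a -/b -/c -/e.
have -> : f x = (a x +i* b x)%C by rewrite /a /b; case: (f x).
have -> : g x = (c x +i* e x)%C by rewrite /c /e; case: (g x).
rewrite /GRing.scale /=.
set a' := 'D_ _ a _; set b' := 'D_ _ b _.
set c' := 'D_ _ c _; set e' := 'D_ _ e _.
by apply/eqP; rewrite eq_complex /=; apply/andP; split; apply/eqP; ring.
Qed.

Lemma partial_cst (R : realType) (n : nat) (c : R[i]) (j : 'I_n) x :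
  cderivable j (fun=> c) x /\ partial j (fun=> c) x = 0.
Proof.
split; first by split; exact: derivable_cst.
by rewrite /partial /rpartial !derive_cst.
Qed.

Lemma partial_conj (R : realType) (n : nat) (f : 'rV[R]_n -> R[i]) j x :
  cderivable j f x ->
  cderivable j (fun y => (f y)^*) x /\
  partial j (fun y => (f y)^*) x = (partial j f x)^*.
Proof.
move=> [fr fi].
have Er : (fun y => complex.Re (f y)^*) = (fun y => complex.Re (f y)).
  by apply/funext => y; case: (f y).
have Ei : (fun y => complex.Im (f y)^*) = - (fun y => complex.Im (f y)).
  by apply/funext => y; rewrite !fctE; case: (f y).
split.
  by rewrite /cderivable Er Ei; split; [apply: fr | apply: (derivableN fi)].
by rewrite /partial /rpartial Er Ei (deriveN fi).
Qed.

Lemma partial_sum (R : realType) (n : nat) (T : Type) (s : seq T)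
    (F : T -> 'rV[R]_n -> R[i]) j x :
  (forall t, cderivable j (F t) x) ->
  cderivable j (fun y => \sum_(t <- s) F t y) x /\
  partial j (fun y => \sum_(t <- s) F t y) x = \sum_(t <- s) partial j (F t) x.
Proof.
move=> dF; elim: s => [|t s [[IHr IHi] IH]].
  under eq_fun do rewrite big_nil.
  by rewrite big_nil; exact: partial_cst.
under eq_fun do rewrite big_cons.
rewrite big_cons -IH; have [tr ti] := dF t.
set G := fun y => \sum_(t <- s) F t y.
have Er : (fun y => complex.Re (F t y + G y)) =
    (fun y => complex.Re (F t y)) + (fun y => complex.Re (G y)).
  by apply/funext => y; rewrite !fctE; case: (F t y); case: (G y).
have Ei : (fun y => complex.Im (F t y + G y)) =
    (fun y => complex.Im (F t y)) + (fun y => complex.Im (G y)).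
  by apply/funext => y; rewrite !fctE; case: (F t y); case: (G y).
split.
  rewrite /cderivable Er Ei.
  by split; [apply: (derivableD tr IHr) | apply: (derivableD ti IHi)].
by rewrite /partial /rpartial Er Ei (deriveD tr IHr) (deriveD ti IHi).
Qed.

(* <P u, v> - <u, P^* v> is a divergence, hence has integral 0 over R^n as soon
   as u or v has compact support. *)
Lemma formal_adjoint1P (R : realType) (n : nat)
    (A : 'I_n -> {set 'I_n} -> {set 'I_n} -> R[i]) (u v : diff_form R n) x :
  (forall I, smooth (u I)) -> (forall I, smooth (v I)) ->
  \sum_J diffop1 A u J x * (v J x)^*
    - \sum_I u I x * (diffop1 (formal_adjoint1 A) v I x)^*
  = \sum_(j < n)
      partial j (fun y => \sum_J \sum_I A j J I * (u I y * (v J y)^*)) x.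
Proof.
move=> su sv.
have du j I : cderivable j (u I) x by exact: smooth_cderivable.
have dv j I : cderivable j (v I) x by exact: smooth_cderivable.
have H j J := partial_conj (dv j J).
have HM j I J := partialM (du j I) (H j J).1.
have HA j I J := partialM (partial_cst (A j J I) j x).1 (HM j I J).1.
have HI j J := partial_sum (index_enum {set 'I_n}) (fun I => (HA j I J).1).
transitivity (\sum_(j < n) \sum_J \sum_I
    (A j J I * (partial j (u I) x * (v J x)^*)
     + A j J I * (u I x * (partial j (v J) x)^*))); last first.
  apply: eq_bigr => j _; rewrite (partial_sum _ (fun J => (HI j J).1)).2.
  apply: eq_bigr => J _; rewrite (HI j J).2.
  apply: eq_bigr => I _.
  rewrite (HA j I J).2 (HM j I J).2 (H j J).2 (partial_cst _ _ _).2.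
  by rewrite mul0r add0r mulrDr.
under [RHS]eq_bigr => j _ do under eq_bigr => J _ do rewrite big_split.
under [RHS]eq_bigr => j _ do rewrite big_split.
rewrite big_split /=; congr (_ + _).
  rewrite exchange_big; apply: eq_bigr => J _.
  rewrite mulr_suml; apply: eq_bigr => j _.
  by rewrite mulr_suml; apply: eq_bigr => I _; rewrite mulrA.
under [RHS]eq_bigr => j _ do rewrite exchange_big.
rewrite exchange_big -sumrN; apply: eq_bigr => I _.
rewrite rmorph_sum mulr_sumr -sumrN; apply: eq_bigr => j _.
rewrite rmorph_sum mulr_sumr -sumrN; apply: eq_bigr => J _.
by rewrite rmorphM /formal_adjoint1 rmorphN /= (conjCK (A j J I)) mulNr
  mulrN opprK mulrCA.
Qed.

End FormalAdjoint.

(* Main.v *)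
Require Import Defs.
From HB Require Import structures.
From mathcomp Require Import all_boot all_order all_algebra.
From mathcomp Require Import complex ring zify.
From mathcomp Require Import all_classical all_reals all_analysis.

Set Implicit Arguments.
Unset Strict Implicit.
Unset Printing Implicit Defensive.

Import Order.TTheory GRing.Theory Num.Theory.
Import numFieldNormedType.Exports.

Local Open Scope classical_set_scope.
Local Open Scope ring_scope.

(** Both identities hold before the restriction to the hyperplane, as identities
    between operators with constant coefficients on forms with smooth
    coefficients.

    Write [t] for the tangential Laplacian and [y] for the derivative along
    [x_n], so that [D = t + y^2] is the Laplacian.  Partial derivatives of
    smooth functions commute ([derive_comm]), hence forms are a module over the
    polynomials in [t] and [y], and [d], its adjoint [delta] and the contraction
    [iota] with the normal field are linear over this ring.  They satisfy
    [d^2 = delta^2 = 0], [d iota + iota d = y], [delta iota + iota delta = 0]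
    and [d delta + delta d = - D].  These five relations follow from the
    anticommutation relations of exterior and interior multiplication, and they
    are all that is used about forms.

    Let [c = n/2 - i - l] and [e = n/2 - i + l]; the parameter mu is [l + 1/2]
    on the left and [- l + 1/2] on the right.  By the relations, Branson's
    operator is [((c - e) d delta - e D) D^(l - 1)].  Composed with the operator
    to (i - 1)-forms (resp. i-forms), it gives a combination of
    [d delta iota w], [delta w], [iota w] (resp. of [d delta w], [d iota w],
    [w]) with coefficients polynomial in [t] and [y].  The two sides agree
    coefficient by coefficient ([sbo_down_branson], [sbo_same_branson]).

    Let [P mu b] be the polynomial of [D^mu_b].  The main identity is
    [P (l + 1/2) a * D^l = K_(l,a) * P (- l + 1/2) (a + 2 l)]
    ([juhl_poly_factor]).  Up to homogenization and normalization, [P mu b] is a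
    Gegenbauer polynomial, and multiplication by [D^l] carries the Gegenbauer
    equation for [l + 1/2] to the one for [- l + 1/2]; a solution is determined
    by its coefficients of degree 0 and 1 in [y], and the constant K compares
    them.  The other coefficients reduce to the derivatives of this identity in
    [t] and [y], because both derivatives of [P mu b] are multiples of some
    [P (mu + 1) b'] ([juhl_poly_dt], [juhl_poly_dy]), to the same identity for
    [a - 1] ([juhl_factor_pred]), and to a three-term relation
    ([juhl_poly_same]). *)

(** * The polynomials of the operators D^mu_b *)

Section JuhlPolynomials.
Variable F : numFieldType.
Implicit Types (mu : F) (p q : {poly {poly F}}) (a b j k l : nat).

(** The factor gamma(mu, a), over any field of characteristic 0. *)
Definition parity_factor mu a : F := if odd a then 1 else mu + a%:R / 2.

Definition shifted_prod mu s n : F := \prod_(p < n) (mu + (s + p)%N%:R).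

Lemma shifted_prod0 mu s : shifted_prod mu s 0 = 1.
Proof. exact: big_ord0. Qed.

Lemma shifted_prodD1 mu s n : shifted_prod (mu + 1) s n = shifted_prod mu s.+1 n.
Proof. by apply: eq_bigr => p _; rewrite addSn -natr1; ring. Qed.

Lemma shifted_prodSl mu s n :
  shifted_prod mu s n.+1 = (mu + s%:R) * shifted_prod mu s.+1 n.
Proof.
rewrite /shifted_prod big_ord_recl addn0; congr (_ * _).
by apply: eq_bigr => p _; rewrite addnS addSn.
Qed.

Lemma shifted_prodSr mu s n :
  shifted_prod mu s n.+1 = shifted_prod mu s n * (mu + (s + n)%N%:R).
Proof. exact: big_ord_recr. Qed.

(** The coefficient of [t^k y^j] in [P mu (j + 2 k)].  In terms of [j] and [k],
    the product runs over [j./2] factors and starts at [uphalf j + k], so that all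
    the relations between coefficients compare shifts of one product. *)
Definition juhl_coef mu j k : F :=
  2 ^+ j / (k`! * j`!)%N%:R * shifted_prod mu (uphalf j + k) j./2.

(** The inner variable is [t], the outer one is [y]. *)
Definition juhl_poly mu b : {poly {poly F}} :=
  \poly_(j < b.+1)
    (if odd (b - j) then 0 else juhl_coef mu j (b - j)./2 *: 'X^((b - j)./2)).

Definition juhl_polyz mu (z : int) : {poly {poly F}} :=
  if z is Posz b then juhl_poly mu b else 0.

(** Only the exponents [j] of [y] with [b - j] even and nonnegative occur in
    [P mu b]; a case analysis along this type puts [b] in the form in which the
    coefficient of [y^j] can be read off. *)
Variant juhl_index j : nat -> Type :=
  | JuhlEven k : juhl_index j (j + k.*2)
  | JuhlOdd k : juhl_index j (j + k.*2.+1)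
  | JuhlOver b of (b < j)%N : juhl_index j b.

Lemma juhl_indexP j b : juhl_index j b.
Proof.
have [ltbj|lejb] := ltnP b j; first exact: JuhlOver.
rewrite -(subnKC lejb) -(odd_double_half (b - j)).
by case: (odd (b - j)); [rewrite add1n; constructor | constructor].
Qed.

Lemma coef_juhl_even mu j k :
  (juhl_poly mu (j + k.*2))`_j = juhl_coef mu j k *: 'X^k.
Proof. by rewrite coef_poly ltnS leq_addr addKn odd_double doubleK. Qed.

Lemma coef_juhl_odd mu j k : (juhl_poly mu (j + k.*2.+1))`_j = 0.
Proof. by rewrite coef_poly ltnS leq_addr addKn /= odd_double. Qed.

Lemma coef_juhl_over mu j b : (b < j)%N -> (juhl_poly mu b)`_j = 0.
Proof. by move=> lt; rewrite coef_poly ltnS leqNgt lt. Qed.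

Definition coef_juhl := (coef_juhl_even, coef_juhl_odd, coef_juhl_over).

Let fact_neq0 n : n`!%:R != 0 :> F.
Proof. by rewrite pnatr_eq0 -lt0n fact_gt0. Qed.
Let succ_neq0 n : n.+1%:R != 0 :> F.
Proof. by rewrite pnatr_eq0. Qed.

Lemma juhl_coef_dy mu j k :
  j.+1%:R * juhl_coef mu j.+1 k =
  2 * parity_factor mu (j.+1 + k.*2) * juhl_coef (mu + 1) j k.
Proof.
rewrite /juhl_coef factS !natrM /= /parity_factor oddD odd_double addbF /= exprS.
rewrite shifted_prodD1 uphalf_half.
case: (boolP (odd j)) => oj /=; last first.
  by rewrite add0n addSn; field; rewrite !fact_neq0 !nat1r succ_neq0.
rewrite add1n shifted_prodSl.
suff -> : (j.+1 + k.*2)%N = (j./2.+1 + k).*2.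
  by rewrite -muln2 natrM; field; rewrite !fact_neq0 !nat1r succ_neq0.
by rewrite -{1}(odd_double_half j) oj doubleD doubleS.
Qed.

Lemma juhl_coef_dt mu j k :
  k.+1%:R * juhl_coef mu j k.+1 = juhl_coef (mu + 1) j k.
Proof.
rewrite /juhl_coef shifted_prodD1 factS !natrM addnS.
by field; rewrite !fact_neq0 !nat1r succ_neq0.
Qed.

(** The Gegenbauer equation, coefficientwise: passing from [j] to [j + 2] adds at
    the end of the product the factor [mu + (uphalf j + k + 1) + j./2], in which
    [uphalf j + j./2 = j], so the parity of [j] disappears. *)
Lemma juhl_coef_ode mu j k :
  (j.+1 * j.+2)%:R * juhl_coef mu j.+2 k =
  4 * k.+1%:R * (mu + (j + k.+1)%:R) * juhl_coef mu j k.+1.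
Proof.
rewrite /juhl_coef !factS !natrM !exprS /= shifted_prodSr addSnnS.
have -> : (uphalf j + k.+1 + j./2 = j + k.+1)%N.
  have ej : (uphalf j + j./2 = j)%N.
    by rewrite uphalf_half -addnA addnn odd_double_half.
  by rewrite addnAC ej.
by field; rewrite !fact_neq0 -[2]/(2%:R) -?natrD !nat1r !succ_neq0.
Qed.

(** All three terms are multiples of the same product of [j./2] factors; which
    factor remains at which end depends on the parity of [j]. *)
Lemma juhl_coef_contiguous mu j k :
  juhl_coef (mu + 1) j k + parity_factor (mu - 1 / 2) (j.+2 + k.*2) *
      juhl_coef mu j.+1 k =
  parity_factor mu (j.+2 + k.*2) * juhl_coef (mu + 1) j.+1 k.
Proof.
rewrite /parity_factor oddD odd_double addbF /= negbK /juhl_coef !shifted_prodD1.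
rewrite factS !natrM /= exprS uphalf_half.
have dj : j%:R = (odd j)%:R + 2 * (j./2)%:R :> F.
  by rewrite -natrM mul2n -natrD odd_double_half.
set c := 2 ^+ j / (k`!%:R * j`!%:R).
have -> : 2 * 2 ^+ j / (k`!%:R * (j.+1%:R * j`!%:R)) = c * (2 / j.+1%:R).
  by rewrite /c; field; rewrite !fact_neq0 nat1r succ_neq0.
have bE : (j.+2 + k.*2)%:R = j%:R + 2 + 2 * k%:R :> F.
  by rewrite -!natrM -!natrD mul2n addn2.
rewrite bE; case: (boolP (odd j)) dj => oj dj.
  have -> : j.+1%:R = 2 * (j./2.+1)%:R :> F by rewrite -natr1 dj -natr1 /=; ring.
  rewrite add1n shifted_prodSl shifted_prodSr addSn -addnS.
  set P := shifted_prod _ _ _; rewrite !natrD -!natr1.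
  by field; rewrite natr1 succ_neq0.
rewrite add0n.
have := shifted_prodSl mu (j./2.+1 + k) j./2; rewrite shifted_prodSr addSn => e.
set P := shifted_prod _ _ _ in e *; set Q := shifted_prod _ _ _ in e *.
have {}dj : j.+1%:R = 2 * (j./2)%:R + 1 :> F by rewrite -natr1 dj add0r.
have dj' : j%:R = 2 * (j./2)%:R :> F by apply: (addIr 1); rewrite natr1 dj.
(* For [j] even the products [P] and [Q] are both the product of [j./2 + 1]
   factors with one end removed. *)
have e' : (mu + (j%:R + 2 + 2 * k%:R) / 2) * Q =
    P * (mu + (2 * (j./2)%:R + k%:R + 1)).
  rewrite dj'; transitivity ((mu + (j./2 + k).+1%:R) * Q).
    by congr (_ * _); rewrite -addn1 !natrD; field.
  by rewrite -e -addn1 !natrD; ring.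
rewrite [RHS]mulrCA e' dj' dj; field.
by rewrite -dj succ_neq0.
Qed.

Lemma juhl_polyz_pred mu a : juhl_polyz mu (a.+1%:Z - 1) = juhl_poly mu a.
Proof. by rewrite -addn1 PoszD addrK. Qed.

Lemma juhl_polyz_pred2 mu a : juhl_polyz mu (a.+2%:Z - 2) = juhl_poly mu a.
Proof. by rewrite -addn2 PoszD addrK. Qed.

Lemma juhl_poly0 mu : juhl_poly mu 0 = 1.
Proof.
rewrite /juhl_poly poly_def big_ord1 /juhl_coef /= !muln1 shifted_prod0.
by rewrite invr1 !mulr1 !expr0 scale1r scale1r.
Qed.

Lemma juhl_poly_dy mu a :
  (juhl_poly mu a)^`() =
  (2 * parity_factor mu a)%:P *: juhl_polyz (mu + 1) (a%:Z - 1).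
Proof.
case: a => [|a]; first by rewrite juhl_poly0 derivC scaler0.
rewrite juhl_polyz_pred; apply/polyP => j; rewrite coef_deriv coefZ.
case: (juhl_indexP j a) => [k|k|b lt].
- rewrite -addSn !coef_juhl -scaler_nat mul_polyC !scalerA juhl_coef_dy.
  by rewrite -scalerA.
- by rewrite -addSn !coef_juhl mul0rn mulr0.
- by rewrite !coef_juhl // mul0rn mulr0.
Qed.

(** The derivative in the inner variable; [deriv] is the one in the outer one. *)
Definition deriv_t p : {poly {poly F}} := map_poly (@deriv F) p.

Lemma coef_deriv_t p j : (deriv_t p)`_j = (p`_j)^`().
Proof. by rewrite coef_map_id0 ?deriv0. Qed.

Lemma deriv_tM p q : deriv_t (p * q) = deriv_t p * q + p * deriv_t q.
Proof.
apply/polyP => j; rewrite coefD coef_deriv_t !coefM raddf_sum -big_split /=.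
by apply: eq_bigr => i _; rewrite derivM !coef_deriv_t.
Qed.

Lemma deriv_tC (c : {poly F}) : deriv_t c%:P = c^`()%:P.
Proof. by apply/polyP=> j; rewrite coef_deriv_t !coefC; case: eqP; rewrite ?deriv0. Qed.

Lemma deriv_tX : deriv_t 'X = 0.
Proof.
by apply/polyP=> j; rewrite coef_deriv_t coefX coef0; case: eqP; rewrite ?derivC ?deriv0.
Qed.

Lemma deriv_tD p q : deriv_t (p + q) = deriv_t p + deriv_t q.
Proof. by apply/polyP=> j; rewrite coefD !coef_deriv_t coefD derivD. Qed.

Lemma juhl_poly_dt mu a :
  deriv_t (juhl_poly mu a) = juhl_polyz (mu + 1) (a%:Z - 2).
Proof.
apply/polyP => j; rewrite coef_deriv_t.
case: a => [|[|a]].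
- by rewrite juhl_poly0 coef1 coef0; case: eqP; rewrite ?derivC ?deriv0.
- rewrite coef0; case e: _ / (juhl_indexP j 1) => [[|k]|k|b lt].
  + by rewrite coef_juhl derivZ derivC scaler0.
  + by move: e; rewrite doubleS !addnS.
  + by rewrite coef_juhl deriv0.
  + by rewrite -e coef_juhl ?deriv0 // e.
rewrite juhl_polyz_pred2; case: (juhl_indexP j a) => [k|k|b lt].
- rewrite -!addnS -doubleS !coef_juhl derivZ derivXn -scaler_nat scalerA mulrC.
  by rewrite juhl_coef_dt.
- by rewrite -!addnS -doubleS !coef_juhl deriv0.
- rewrite (coef_juhl_over _ lt); case e: _ / (juhl_indexP j b.+2) => [[|k]|k|b' lt'].
  + by rewrite coef_juhl derivZ derivC scaler0.
  + by move: e lt; rewrite doubleS !addnS => [][->]; rewrite ltnNge leq_addr.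
  + by rewrite coef_juhl deriv0.
  + by rewrite coef_juhl // deriv0.
Qed.

(** [P mu a] is homogeneous of degree [a] when [y] has degree 1 and [t] degree 2. *)
Lemma juhl_poly_euler mu a :
  a%:R * juhl_poly mu a =
  'X * (juhl_poly mu a)^`() + 2 * 'X%:P * deriv_t (juhl_poly mu a).
Proof.
apply/polyP => j.
have h : (2 * 'X%:P * deriv_t (juhl_poly mu a))`_j
    = 2 * ('X * ((juhl_poly mu a)`_j)^`()).
  by rewrite -[2]/(2%:R) -mulrA mulr_natl coefMn coefCM coef_deriv_t mulr_natl.
rewrite coefD h mulr_natl coefMn coefXM {h}.
have -> : (if j == 0 then 0 else (juhl_poly mu a)^`()`_j.-1)
    = (juhl_poly mu a)`_j *+ j.
  by case: j => [|j] //=; rewrite coef_deriv.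
case: (juhl_indexP j a) => [k|k|b lt]; rewrite !coef_juhl ?mul0rn //.
- rewrite derivZ derivXn mulrnDr -mul2n mulrnA; congr (_ + _).
  rewrite -[in RHS]mulr_natl -scalerAr mulrnAr -[_ *+ k]scaler_nat.
  case: k => [|k] /=; first by rewrite scaler0 !mulr0 scale0r.
  by rewrite mulr1 exprS mulr_natl !scaler_nat -scalerMnr -!mulrnA mulnC.
- by rewrite derivC !mulr0 addr0.
- by rewrite derivC !mulr0 addr0.
Qed.

Lemma juhl_poly_contiguous mu b :
  'X * juhl_polyz (mu + 1) (b%:Z - 1)
    + (parity_factor (mu - 1 / 2) b.+1)%:P *: juhl_poly mu b =
  (parity_factor mu b.+1)%:P *: juhl_poly (mu + 1) b.
Proof.
apply/polyP => [[|j]]; rewrite coefD coefXM !coefZ /=.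
  rewrite add0r; case: (juhl_indexP 0 b) => [k|k|//].
    rewrite !coef_juhl /parity_factor !add0n /= odd_double /=.
    by rewrite /juhl_coef !shifted_prod0.
  by rewrite !coef_juhl !mulr0.
case: b => [|b]; first by rewrite coef0 !coef_juhl // !mulr0 addr0.
rewrite juhl_polyz_pred; case: (juhl_indexP j b) => [k|k|b' lt].
- by rewrite -!addSn !coef_juhl !mul_polyC !scalerA -scalerDl juhl_coef_contiguous.
- by rewrite -!addSn !coef_juhl !mulr0 addr0.
- by rewrite !coef_juhl // !mulr0 addr0.
Qed.

(** Euler's identity expresses [a P mu a] through [P (mu + 1) (a - 1)] and
    [P (mu + 1) (a - 2)], and the contiguity relation replaces the former by
    [P mu (a - 1)]. *)
Lemma juhl_poly_same mu a :
  2 * juhl_polyz (mu + 1) (a%:Z - 2) * ('X%:P + 'X ^+ 2)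
    + 2 * (parity_factor (mu - 1 / 2) a)%:P%:P * 'X * juhl_polyz mu (a%:Z - 1) =
  a%:R * juhl_poly mu a.
Proof.
rewrite juhl_poly_euler juhl_poly_dy juhl_poly_dt.
case: a => [|a]; first by rewrite /= !(mulr0, mul0r, scaler0, addr0).
have := juhl_poly_contiguous mu a; rewrite !juhl_polyz_pred.
have -> : a.+1%:Z - 2 = a%:Z - 1 by rewrite -addn1 PoszD; ring.
rewrite -!mul_polyC polyCM; move: (juhl_polyz _ _) (juhl_poly _ _) (juhl_poly _ _).
move=> p q r; rewrite -[2%:P]/(2%:R%:P) polyC_natr polyCM.
rewrite polyC_natr => e.
transitivity (2 * p * 'X%:P + 2 * 'X * ('X * p +
   (parity_factor (mu - 1 / 2) a.+1)%:P%:P * r)); first by ring.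
by rewrite e; ring.
Qed.

(** For [c = 2 mu + 1] and [t = -1], the eigenvalue equation of this operator is
    the Gegenbauer equation
    [(1 - y^2) p'' - (2 mu + 1) y p' + a (a + 2 mu) p = 0]. *)
Definition gegenbauer_op (c : F) p : {poly {poly F}} :=
  ('X%:P + 'X ^+ 2) * p^`()^`() + c%:P%:P * 'X * p^`().

Lemma coef_gegenbauer_op c p j :
  (gegenbauer_op c p)`_j =
  (j.+1 * j.+2)%:R * 'X * p`_j.+2 + (j%:R * (j%:R - 1 + c))%:P * p`_j.
Proof.
rewrite /gegenbauer_op mulrDl !coefD coefCM -mulrA coefCM -addrA; congr (_ + _).
  by rewrite !coef_deriv -mulrnA mulnC mulrnAr -mulr_natl mulrA.
rewrite coefXnM coefXM; case: j => [|[|j]] /=.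
- by rewrite add0r mulr0 mul0r polyC0 mul0r.
- rewrite add0r coef_deriv mulr1n; congr (_%:P * _); ring.
rewrite subn2 /= !coef_deriv -mulrnA -[_ *+ j.+2]mulr_natl.
rewrite -[_ *+ (_ * _)]mulr_natl mulrA -mulrDl; congr (_ * _).
rewrite -!polyC_natr -!polyCM -polyCD natrM; congr (_%:P).
by rewrite -!natr1; ring.
Qed.

(** The equation determines [(j + 1) (j + 2) t] times the coefficient of
    [y^(j + 2)] from that of [y^j], and [(j + 1) (j + 2) t] is not a zero
    divisor. *)
Lemma gegenbauer_uniq c (e : {poly F}) p q :
  gegenbauer_op c p = e *: p -> gegenbauer_op c q = e *: q ->
  p`_0 = q`_0 -> p`_1 = q`_1 -> p = q.
Proof.
move=> ep eq pq0 pq1.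
suff h j : p`_j = q`_j /\ p`_j.+1 = q`_j.+1 by apply/polyP => j; case: (h j).
elim: j => [//|j [ihj ihj1]]; split=> //.
have nz : (j.+1 * j.+2)%:R * 'X != 0 :> {poly F}.
  by rewrite mulf_neq0 ?polyX_eq0 // -polyC_natr polyC_eq0 pnatr_eq0.
apply: (mulfI nz); apply: (addIr ((j%:R * (j%:R - 1 + c))%:P * p`_j)).
by rewrite {2}ihj -!coef_gegenbauer_op ep eq !coefZ ihj.
Qed.

Lemma juhl_poly_ode mu a :
  gegenbauer_op (2 * mu + 1) (juhl_poly mu a) =
  (a%:R * (a%:R + 2 * mu))%:P *: juhl_poly mu a.
Proof.
apply/polyP => j; rewrite coefZ coef_gegenbauer_op.
case: (juhl_indexP j a) => [[|k]|[|k]|b lt].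
- rewrite double0 (coef_juhl_over mu (b := j + 0)) ?addn0 // mulr0 add0r.
  by congr (_%:P * _); ring.
- have -> : (j + k.+1.*2 = j.+2 + k.*2)%N by rewrite doubleS !addnS.
  rewrite [X in _ * X + _]coef_juhl !addSn -!addnS -doubleS !coef_juhl.
  rewrite -polyC_natr !mul_polyC -scalerAl -scalerAr -exprS !scalerA -scalerDl.
  rewrite juhl_coef_ode; congr (_ *: _).
  by rewrite -mul2n !natrD natrM -!natr1; ring.
- by rewrite (coef_juhl_odd mu j 0) double0 coef_juhl_over ?addn1 // !mulr0 addr0.
- have -> : (j + k.+1.*2.+1 = j.+2 + k.*2.+1)%N by rewrite doubleS !addnS.
  by rewrite coef_juhl !addSn -!addnS -doubleS coef_juhl !mulr0 addr0.
- by rewrite !coef_juhl_over ?mulr0 ?addr0 //; do 2?apply: leqW.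
Qed.

(** Conjugation by [D^l]: the terms with the first derivative of [D^l] times [p]
    cancel for this choice of the parameter. *)
Lemma gegenbauer_op_factor l p :
  gegenbauer_op (2 - 2 * l%:R) (('X%:P + 'X ^+ 2) ^+ l * p) =
  ('X%:P + 'X ^+ 2) ^+ l * (gegenbauer_op (2 * l%:R + 2) p + 2 * l%:R * p).
Proof.
rewrite /gegenbauer_op; set D := 'X%:P + 'X ^+ 2 : {poly {poly F}}.
have dD : D^`() = 2 * 'X by rewrite derivD derivC derivXn add0r mulr_natl.
set h := D ^+ l.
have dh : D * h^`() = 2 * l%:R * 'X * h.
  rewrite deriv_exp dD {}/h; case: (l) => [|m]; first by rewrite mulr0n !mulr0 !mul0r.
  by rewrite -mulr_natl exprS /=; ring.
have ddh : D * h^`()^`() = 2 * l%:R * h + 2 * (l%:R - 1) * 'X * h^`().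
  have := congr1 (@deriv _) dh; rewrite -mulrA -natrM mulr_natl derivMn !derivM dD.
  rewrite derivX mul1r => /(canRL (addKr _)) ->.
  by rewrite -mulr_natl natrM; ring.
rewrite !derivM derivD !derivM !mulrDr.
transitivity (h * (D * p^`()^`()) + 2 * (D * h^`()) * p^`() + D * h^`()^`() * p
   + (2 - 2 * l%:R)%:P%:P * 'X * (h^`() * p + h * p^`())); first by ring.
have pE n : n%:R%:P%:P = n%:R :> {poly {poly F}} by rewrite !polyC_natr.
rewrite dh ddh !(polyCD, polyCN, polyCM) !pE.
by ring.
Qed.

Lemma K_coef_fact l a : (K_coef l a * (a./2)`! = (a./2 + l)`!)%N.
Proof.
elim: l => [|l IH]; first by rewrite /K_coef big_geq // mul1n addn0.
by rewrite /K_coef big_nat_recr //= mulnAC IH addnS factS mulnC.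
Qed.

(** For [j < 2] the product in [juhl_coef] is empty, and the coefficient of lowest
    degree in [y] is [2^j / k!]; so K is the ratio of two factorials. *)
Lemma K_coef_juhl_coef l k j : (j < 2)%N ->
  juhl_coef (l%:R + 1 / 2) j k =
  (K_coef l (j + k.*2))%:R * juhl_coef (- l%:R + 1 / 2) j (k + l).
Proof.
move=> lt; have hj : (j + k.*2)./2 = k.
  by case: j lt => [|[|]] //= _; rewrite ?uphalf_double ?doubleK.
have : (K_coef l (j + k.*2) * k`! = (k + l)`!)%N by rewrite -{2}hj K_coef_fact hj.
move=> /(congr1 (fun x : nat => x%:R : F)); rewrite natrM => e.
have j2 : j./2 = 0%N by case: j lt {hj e} => [|[|]].
rewrite /juhl_coef j2 !shifted_prod0 !mulr1 !natrM -e.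
have rN0 : (K_coef l (j + k.*2))%:R != 0 :> F.
  apply: contra_eq_neq e => ->; rewrite mul0r eq_sym; exact: fact_neq0.
by field; rewrite !fact_neq0.
Qed.

Lemma coef01_lapX l p :
  (('X%:P + 'X ^+ 2) ^+ l * p)`_0 = 'X^l * p`_0 /\
  (('X%:P + 'X ^+ 2) ^+ l * p)`_1 = 'X^l * p`_1.
Proof.
elim: l p => [|l IH] p; first by rewrite !expr0 !mul1r.
rewrite exprSr -mulrA; have [-> ->] := IH (('X%:P + 'X ^+ 2) * p).
rewrite !mulrDl !coefD !coefCM !coefXnM /= !addr0 exprSr.
by rewrite -!mulrA.
Qed.

(** Both sides solve the same Gegenbauer equation, with eigenvalue
    [(a + 2 l) (a + 1)]. *)
Lemma juhl_poly_factor l a :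
  juhl_poly (l%:R + 1 / 2) a * ('X%:P + 'X ^+ 2) ^+ l =
  (K_coef l a)%:R * juhl_poly (- l%:R + 1 / 2) (a + 2 * l).
Proof.
rewrite mulrC; apply: (@gegenbauer_uniq (2 - 2 * l%:R)
  ((a%:R + 2 * l%:R) * (a%:R + 1))%:P).
- rewrite gegenbauer_op_factor.
  have -> : 2 * l%:R + 2 = 2 * (l%:R + 1 / 2) + 1 :> F.
    by field.
  rewrite juhl_poly_ode -!mul_polyC.
  have -> : 2 * l%:R = (2 * l%:R)%:P%:P :> {poly {poly F}}.
    by rewrite !polyCM !polyC_natr.
  rewrite -mulrDl -!polyCD mulrCA; congr (_%:P%:P * _).
  by field.
- have linG c (n : nat) p : gegenbauer_op c (n%:R * p) = n%:R * gegenbauer_op c p.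
    by rewrite !mulr_natl /gegenbauer_op !derivMn !mulrnAr mulrnDl.
  rewrite linG.
  have -> : 2 - 2 * l%:R = 2 * (- l%:R + 1 / 2) + 1 :> F.
    by field.
  rewrite juhl_poly_ode scalerAr; congr (_ * (_%:P *: _)).
  by rewrite natrD natrM; field.
- rewrite (coef01_lapX _ _).1 mulr_natl coefMn.
  case: (juhl_indexP 0 a) => [k|k|//].
    rewrite coef_juhl mul2n -addnA -doubleD coef_juhl K_coef_juhl_coef //.
    by rewrite -scalerAr -exprD (addnC l) -scalerA scaler_nat.
  by rewrite coef_juhl mul2n -addnA addSn -doubleD coef_juhl mul0rn mulr0.
- rewrite (coef01_lapX _ _).2 mulr_natl coefMn.
  case: (juhl_indexP 1 a) => [k|k|[|]//].
  + rewrite coef_juhl mul2n -addnA -doubleD coef_juhl K_coef_juhl_coef //.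
    by rewrite -scalerAr -exprD (addnC l) -scalerA scaler_nat.
  + by rewrite coef_juhl mul2n -addnA [(k.*2.+1 + _)%N]addSn -doubleD coef_juhl mul0rn mulr0.
  + move=> _; rewrite coef_juhl // mulr0 add0n mul2n.
    case: l => [|l]; first by rewrite coef_juhl // mul0rn.
    by rewrite doubleS -add1n (coef_juhl_odd _ 1 l) mul0rn.
Qed.

End JuhlPolynomials.

Section JuhlSum.
Variable F : numFieldType.

Lemma juhl_coefE (mu : F) b k : (k < b./2.+1)%N ->
  2 ^+ (b - 2 * k) / (k`! * (b - 2 * k)`!)%N%:R
    * \prod_((b.+1)./2 <= p < b - k) (mu + p%:R) = juhl_coef mu (b - 2 * k) k.
Proof.
move=> kb; rewrite /juhl_coef; congr (_ * _).
have -> : (b.+1./2 = 0 + (uphalf (b - 2 * k) + k))%N by lia.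
rewrite big_addn big_mkord /shifted_prod.
have -> : (b - k - (uphalf (b - 2 * k) + k) = (b - 2 * k)./2)%N by lia.
by apply: eq_bigr => p _; rewrite addnC.
Qed.

Lemma juhl_poly_sum (mu : F) b : juhl_poly mu b =
  \sum_(0 <= k < b./2.+1) (juhl_coef mu (b - 2 * k) k *: 'X^k) *: 'X^(b - 2 * k).
Proof.
apply/polyP => j; rewrite coef_sum.
under eq_bigr do rewrite coefZ coefXn.
case: (juhl_indexP j b) => [k|k|b' lt].
- rewrite coef_juhl (bigD1_seq k) ?mem_index_iota ?iota_uniq //=; last by lia.
  rewrite big1_seq ?addr0 => [|i /andP[ik]]; rewrite ?mem_index_iota.
    have -> : (j + k.*2 - 2 * k = j)%N by lia.
    by rewrite eqxx mulr1.
  move=> il; rewrite (_ : (j == _) = false) ?mulr0 //; lia.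
- rewrite coef_juhl big_nat big1 // => i ik.
  rewrite (_ : (j == _) = false) ?mulr0 //; lia.
- rewrite coef_juhl // big1 // => i _.
  rewrite (_ : (j == _) = false) ?mulr0 //; lia.
Qed.
End JuhlSum.

Section DerivedFactorizations.
Variable F : numFieldType.
Implicit Types (mu : F) (p q : {poly {poly F}}) (a b j k l : nat).
Local Notation S := {poly {poly F}}.
Local Notation D := ('X%:P + 'X ^+ 2 : S).

Lemma deriv_t_lapX l : deriv_t (D ^+ l.+1) = l.+1%:R * D ^+ l.
Proof.
have dD : deriv_t D = 1.
  by rewrite deriv_tD deriv_tC derivX expr2 deriv_tM deriv_tX mul0r mulr0 !addr0.
elim: l => [|l IH]; first by rewrite expr1 dD expr0 mulr1.
by rewrite exprS deriv_tM IH dD [l.+2%:R]mulrS exprS; ring.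
Qed.

(** The derivative of [juhl_poly_factor] with respect to [t]; [D] has derivative 1. *)
Lemma juhl_factor_dt l a (mu := l.+1%:R + 1 / 2) (mu' := - l.+1%:R + 1 / 2) :
  juhl_polyz (mu + 1) (a%:Z - 2) * D ^+ l.+1
    + l.+1%:R * juhl_poly mu a * D ^+ l =
  (K_coef l.+1 a)%:R * juhl_polyz (mu' + 1) ((a + 2 * l.+1)%:Z - 2).
Proof.
have := congr1 (@deriv_t F) (juhl_poly_factor F l.+1 a).
have dtn (n : nat) : deriv_t (n%:R) = 0 :> S.
  by rewrite -polyC_natr deriv_tC -polyC_natr derivC.
rewrite !deriv_tM deriv_t_lapX dtn !juhl_poly_dt mul0r add0r => <-.
by congr (_ + _); ring.
Qed.

(** Half of the derivative of [juhl_poly_factor] with respect to [y]. *)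
Lemma juhl_factor_dy l a (mu := l.+1%:R + 1 / 2) (mu' := - l.+1%:R + 1 / 2) :
  (parity_factor mu a)%:P%:P * juhl_polyz (mu + 1) (a%:Z - 1) * D ^+ l.+1
    + l.+1%:R * 'X * juhl_poly mu a * D ^+ l =
  (K_coef l.+1 a)%:R * (parity_factor mu' (a + 2 * l.+1))%:P%:P
    * juhl_polyz (mu' + 1) ((a + 2 * l.+1)%:Z - 1).
Proof.
have := congr1 (@deriv _) (juhl_poly_factor F l.+1 a).
have dn (n : nat) : (n%:R)^`() = 0 :> S by rewrite -polyC_natr derivC.
rewrite !derivM deriv_exp derivD derivC derivXn dn mul0r !add0r.
rewrite !juhl_poly_dy -/mu -/mu' -!mul_polyC !polyCM !polyC_natr /=.
move: (juhl_polyz _ _) (juhl_polyz _ _) (juhl_poly _ _) (D ^+ l.+1) (D ^+ l).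
move=> p p' q u v.
rewrite expr1 -[_ *+ l.+1]mulr_natl -[_ *+ 2]mulr_natl => e.
have two0 : 2 != 0 :> S.
  by rewrite -polyC_natr polyC_eq0 -polyC_natr polyC_eq0 pnatr_eq0.
by apply: (mulfI two0); apply: (etrans _ (etrans e _)); ring.
Qed.

Lemma K_coef_succ l a : odd a ->
  (K_coef l a.+1 * a./2.+1 = K_coef l a * (a./2.+1 + l))%N.
Proof.
move=> oa; apply/eqP; rewrite -(eqn_pmul2r (fact_gt0 a./2)) -mulnA -factS.
have := K_coef_fact l a.+1; rewrite /= uphalf_half oa add1n => ->.
by rewrite mulnAC K_coef_fact mulnC addSn factS.
Qed.

(** For [a] odd this is [juhl_poly_factor] at [a - 1], with the same constant K.
    For [a > 0] even, K at [a - 1] differs from K at [a] by the quotient of the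
    two parity factors, by [K_coef_succ]; for [a = 0] both sides vanish. *)
Lemma juhl_factor_pred l a (mu := l.+1%:R + 1 / 2) (mu' := - l.+1%:R + 1 / 2) :
  (parity_factor (mu - 1 / 2) a)%:P%:P * juhl_polyz mu (a%:Z - 1) * D ^+ l.+1 =
  (K_coef l.+1 a)%:R * (parity_factor (mu' - 1 / 2) (a + 2 * l.+1))%:P%:P
    * juhl_polyz mu' ((a + 2 * l.+1)%:Z - 1).
Proof.
rewrite /mu /mu' !addrK.
case: a => [|a].
  rewrite /= mulr0 mul0r add0n /parity_factor mul2n odd_double -muln2 natrM.
  by rewrite mulfK ?pnatr_eq0 // addNr !(polyC0, mulr0, mul0r).
rewrite addSn !juhl_polyz_pred -mulrA juhl_poly_factor.
rewrite mulrCA !mulrA; congr (_ * _); rewrite mulrC /parity_factor /=.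
rewrite mul2n oddD odd_double addbF.
case: (boolP (odd a)) => oa /=; last first.
  by rewrite mulrC /K_coef /= uphalf_half (negbTE oa).
have aE : a.+1%:R = 2 * (a./2.+1)%:R :> F.
  by rewrite -natrM mul2n doubleS -[in LHS](odd_double_half a) oa.
rewrite -!polyC_natr -!polyCM; congr (_%:P%:P).
have := congr1 (fun n : nat => n%:R : F) (K_coef_succ l.+1 oa).
rewrite !natrM natrD => e.
transitivity ((K_coef l.+1 a)%:R * ((a./2.+1)%:R + l.+1%:R) : F).
  by rewrite aE; field.
by rewrite -e -addSn natrD -mul2n natrM aE; field.
Qed.
End DerivedFactorizations.

(** * Factorization in a module over the polynomials in t and y *)

Section CollectScalars.
Variables (S : comNzRingType) (M : lmodType S).
Implicit Types (x y z : M).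

(** The two sides of each factorization are combinations of three vectors, with
    scalars distributed over several levels; it suffices to compare the total
    scalars of each vector. *)
Lemma collect_down (c1 c2 c3 p1 p2 p3 A B A' B' C k q1 q2 q3 r1 r2 r3 : S) x y z :
  c1 * p1 * A + c3 * p3 * A' = k * (r1 * q1) ->
  c2 * p2 * B + c3 * p3 * B' = k * (r2 * q2) ->
  c3 * p3 * C = k * (r3 * q3) ->
  c1 *: (p1 *: (A *: x))
    + (c2 *: (p2 *: (B *: y)) + c3 *: (p3 *: (A' *: x + B' *: y + C *: z))) =
  k *: (r1 *: (q1 *: x) + (r2 *: (q2 *: y) + r3 *: (q3 *: z))).
Proof.
move=> e1 e2 e3; rewrite !(scalerDr, scalerA) -!mulrA -e1 -e2 -e3 !scalerDl.
by rewrite !mulrA [in RHS]addrA [in RHS]addrACA -!addrA; congr (_ + _); rewrite addrCA.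
Qed.

Lemma collect_same (c2 c3 p1 p2 p3 A A' A'' B C k q1 q2 q3 r2 r3 : S) x y z :
  p1 * A + c2 * p2 * A' + c3 * p3 * A'' = k * q1 ->
  c2 * p2 * B = k * (r2 * q2) ->
  c3 * p3 * C = k * (r3 * q3) ->
  p1 *: (A *: x)
    + (c2 *: (p2 *: (A' *: x + B *: y)) + c3 *: (p3 *: (A'' *: x + C *: z))) =
  k *: (q1 *: x + (r2 *: (q2 *: y) + r3 *: (q3 *: z))).
Proof.
move=> e1 e2 e3; rewrite !(scalerDr, scalerA) -!mulrA -e1 -e2 -e3 !scalerDl.
by rewrite !mulrA -!addrA; congr (_ + (_ + _)); rewrite addrCA.
Qed.
End CollectScalars.

Section FormAlgebra.
Variable F : numFieldType.
Local Notation S := {poly {poly F}}.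
Local Notation D := ('X%:P + 'X ^+ 2 : S).
(* [d], [de] and [io] stand for the exterior derivative, its adjoint and the
   contraction with the normal field. *)
Variables (M : lmodType S) (d de io : {linear M -> M}).
Hypothesis dd : forall w, d (d w) = 0.
Hypothesis dede : forall w, de (de w) = 0.
Hypothesis dio : forall w, d (io w) + io (d w) = 'X *: w.
Hypothesis deio : forall w, de (io w) + io (de w) = 0.
Hypothesis lap : forall w, d (de w) + de (d w) = - (D *: w).

Implicit Types (w : M) (c e kappa : F) (mu : F) (a l : nat).

(** Branson's operator of order [2 (l + 1)]. *)
Definition branson_op c e l w : M :=
  let v := D ^+ l *: w in
  c%:P%:P *: d (de v) + e%:P%:P *: de (d v).

Definition down_op mu kappa a w : M :=
  (-1)%:P%:P *: (juhl_polyz (mu + 1) (a%:Z - 2) *: d (de (io w)))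
  + ((- parity_factor mu a)%:P%:P *:
       (juhl_polyz (mu + 1) (a%:Z - 1) *: de w)
     + kappa%:P%:P *: (juhl_poly mu a *: io w)).

Definition same_op mu kappa a w : M :=
  juhl_polyz (mu + 1) (a%:Z - 2) *: d (de w)
  + ((- parity_factor (mu - 1 / 2) a)%:P%:P *:
       (juhl_polyz mu (a%:Z - 1) *: d (io w))
     + kappa%:P%:P *: (juhl_poly mu a *: w)).

Lemma opp_anticommutator w :
  (-1)%:P%:P *: (d (de w) + de (d w)) = D *: w.
Proof. by rewrite lap !polyCN scaleNr scale1r opprK. Qed.

Lemma de_d_de w : de (d (de w)) = - (D *: de w).
Proof. by have := lap (de w); rewrite dede linear0 add0r. Qed.

Lemma io_d_de w : io (d (de w)) = 'X *: de w + d (de (io w)).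
Proof.
have /(canRL (addKr _)) -> := dio (de w).
have /eqP := deio w; rewrite addrC addr_eq0 => /eqP ->.
by rewrite linearN opprK addrC.
Qed.

(** Eliminating [de (d w)] leaves the single second order term [d (de w)]; the
    operators below are therefore computed on combinations of [d (de w)] and
    [w]. *)
Lemma branson_opE c e l w :
  branson_op c e l w =
  ((c - e)%:P%:P * D ^+ l) *: d (de w) + (- (e%:P%:P * D ^+ l.+1)) *: w.
Proof.
have lapw : de (d w) = - (D *: w) - d (de w).
  by rewrite -lap addrAC addrN add0r.
rewrite /branson_op ![in LHS]linearZ /= lapw !scalerBr !scalerN !scalerA addrCA.
rewrite -scalerBl addrC -scaleNr !polyCB (exprSr _ l).
by congr (_ *: _ + _ *: _); ring.
Qed.

Lemma io_comb (p q : S) w :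
  io (p *: d (de w) + q *: w) =
  p *: d (de (io w)) + (p * 'X) *: de w + q *: io w.
Proof.
by rewrite linearP linearZ /= io_d_de scalerDr scalerA [X in X + _]addrC.
Qed.

Lemma de_comb (p q : S) w :
  de (p *: d (de w) + q *: w) = (q - p * D) *: de w.
Proof.
by rewrite linearP linearZ /= de_d_de scalerN scalerA addrC -scalerBl.
Qed.

Lemma d_de_comb (p q : S) w :
  d (de (p *: d (de w) + q *: w)) = (q - p * D) *: d (de w).
Proof. by rewrite de_comb linearZ. Qed.

Lemma d_io_comb (p q : S) w :
  d (io (p *: d (de w) + q *: w)) =
  (p * 'X) *: d (de w) + q *: d (io w).
Proof.
by rewrite io_comb -addrA 2!linearP linearZ /= dd scaler0 add0r.
Qed.

Lemma d_de_io_comb (p q : S) w :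
  d (de (io (p *: d (de w) + q *: w))) = (q - p * D) *: d (de (io w)).
Proof.
by rewrite io_comb -addrA addrCA linearP /= dede scaler0 add0r d_de_comb.
Qed.

(** Here [c] and [e] are [n/2 - i - (l + 1)] and [n/2 - i + (l + 1)]. *)
Lemma sbo_down_branson l a c e w : e - c = 2 * l.+1%:R ->
  down_op (l.+1%:R + 1 / 2) (- c / 2) a (branson_op c e l w) =
  (- c * (K_coef l.+1 a)%:R)%:P%:P *:
    down_op (- l.+1%:R + 1 / 2) (- e / 2) (a + 2 * l.+1) w.
Proof.
move=> ec; have cE : c - e = - (2 * l.+1%:R) by rewrite -ec opprB.
rewrite branson_opE /down_op d_de_io_comb de_comb io_comb.
have -> : - (e%:P%:P * D ^+ l.+1) - (c - e)%:P%:P * D ^+ l * D =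
    - (c%:P%:P * D ^+ l.+1) by rewrite !polyCB (exprSr _ l); ring.
have := juhl_factor_dt F l a; have := juhl_factor_dy F l a.
have := juhl_poly_factor F l.+1 a => /=.
rewrite cE.
set p1 := juhl_polyz _ (a%:Z - 2); set p2 := juhl_polyz _ (a%:Z - 1).
set p3 := juhl_poly _ a.
set q1 := juhl_polyz _ (_ - 2); set q2 := juhl_polyz _ (_ - 1).
set q3 := juhl_poly _ _; set K : S := (K_coef _ _)%:R => e3.
move: (parity_factor _ _) (parity_factor _ _) => g' g e2 e1.
(* An opaque inverse of 2, so that the remaining identities are polynomial. *)
have [h halfE hh] : exists2 h : F, forall u, u / 2 = u * h & 2 * h = 1.
  by exists 2^-1 => //; rewrite divff ?pnatr_eq0.
rewrite !halfE !(polyCM, polyCN) !polyC_natr ?polyC1 -/K.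
have {}hh : 2 * h%:P%:P = 1 :> S.
  by rewrite -[2]/(2%:R) -!polyC_natr -!polyCM hh.
apply: collect_down.
- transitivity (c%:P%:P * (p1 * D ^+ l.+1
    + 2 * h%:P%:P * (l.+1%:R * p3 * D ^+ l))); first by ring.
  by rewrite hh mul1r e1; ring.
- transitivity (c%:P%:P * (g%:P%:P * p2 * D ^+ l.+1
    + 2 * h%:P%:P * (l.+1%:R * 'X * p3 * D ^+ l))); first by ring.
  by rewrite hh mul1r e2; ring.
- transitivity (c%:P%:P * e%:P%:P * h%:P%:P * (p3 * D ^+ l.+1)); first by ring.
  by rewrite e3; ring.
Qed.

(** The coefficient of [d (de w)] is [- e] times the [t]-derivative of the main
    identity, up to a multiple of a difference which vanishes by
    [juhl_poly_same]. *)
Lemma sbo_same_branson l a c e w : e - c = 2 * l.+1%:R ->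
  same_op (l.+1%:R + 1 / 2) ((e + a%:R) / 2) a (branson_op c e l w) =
  (- e * (K_coef l.+1 a)%:R)%:P%:P *:
    same_op (- l.+1%:R + 1 / 2) ((e + a%:R) / 2) (a + 2 * l.+1) w.
Proof.
move=> ec; have cE : c - e = - (2 * l.+1%:R) by rewrite -ec opprB.
rewrite branson_opE /same_op d_de_comb d_io_comb.
have -> : - (e%:P%:P * D ^+ l.+1) - (c - e)%:P%:P * D ^+ l * D =
    - (c%:P%:P * D ^+ l.+1) by rewrite !polyCB (exprSr _ l); ring.
have := juhl_poly_same (l.+1%:R + 1 / 2 : F) a.
have := juhl_factor_dt F l a; have := juhl_factor_pred F l a.
have := juhl_poly_factor F l.+1 a => /=.
have -> : c%:P%:P = e%:P%:P - 2 * l.+1%:R :> S.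
  by rewrite -(subrK e c) cE !(polyCD, polyCN, polyCM) !polyC_natr addrC.
rewrite cE.
set p1 := juhl_polyz _ (a%:Z - 2); set p2 := juhl_polyz _ (a%:Z - 1).
set p3 := juhl_poly _ a.
set q1 := juhl_polyz _ (_ - 2); set q2 := juhl_polyz _ (_ - 1).
set q3 := juhl_poly _ _; set K : S := (K_coef _ _)%:R => e3.
move: (parity_factor _ _) (parity_factor _ _) => g' g e2 e1 e0.
(* An opaque inverse of 2, so that the remaining identities are polynomial. *)
have [h halfE hh] : exists2 h : F, forall u, u / 2 = u * h & 2 * h = 1.
  by exists 2^-1 => //; rewrite divff ?pnatr_eq0.
rewrite !halfE !(polyCM, polyCN) !polyC_natr !polyCD !polyC_natr ?polyC1 -/K.
have {}hh : 2 * h%:P%:P = 1 :> S.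
  by rewrite -[2]/(2%:R) -!polyC_natr -!polyCM hh.
apply: collect_same.
- transitivity (- e%:P%:P * (p1 * D ^+ l.+1
      + 2 * h%:P%:P * (l.+1%:R * p3 * D ^+ l))
    + l.+1%:R * D ^+ l * (2 * p1 * D + 2 * g%:P%:P * 'X * p2
      - 2 * h%:P%:P * (a%:R * p3))); first by rewrite (exprS _ l); ring.
  by rewrite hh !mul1r e1 e0 subrr mulr0 addr0 mulrA.
- transitivity (e%:P%:P * (g%:P%:P * p2 * D ^+ l.+1)); first by ring.
  by rewrite e2; ring.
- transitivity (- (e%:P%:P * (e%:P%:P + a%:R) * h%:P%:P * (p3 * D ^+ l.+1))).
    by ring.
  by rewrite e3; ring.
Qed.

End FormAlgebra.

(** * Constant coefficient operators as scalars *)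

Section PolyModule.
Variables (K : comNzRingType) (M : lmodType K).

(** A copy of [M] on which the variable acts as [phi]. *)
Definition poly_module (phi : {linear M -> M}) : Type := M.

Variable phi : {linear M -> M}.
HB.instance Definition _ := GRing.Zmodule.copy (poly_module phi) M.

Definition poly_scale (p : {poly K}) (v : poly_module phi) : poly_module phi :=
  \sum_(i < size p) p`_i *: iter i phi v.

Implicit Types p q r s : {poly K}.

Lemma poly_scale_widen p v n : (size p <= n)%N ->
  poly_scale p v = \sum_(i < n) p`_i *: iter i phi v.
Proof.
move=> le; rewrite /poly_scale (big_ord_widen n (fun i => p`_i *: iter i phi v) le).
rewrite big_mkcond; apply: eq_bigr => i _; case: ltnP => // /(nth_default 0) ->.
by rewrite scale0r.
Qed.

Lemma poly_scaleDl v : {morph poly_scale^~ v : p q / p + q}.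
Proof.
move=> p q; have le := size_polyD p q.
rewrite (poly_scale_widen _ le) (poly_scale_widen v (leq_maxl (size p) (size q))).
rewrite (poly_scale_widen v (leq_maxr (size p) (size q))) -big_split /=.
by apply: eq_bigr => i _; rewrite coefD scalerDl.
Qed.

Lemma iter_phi_lin i (a : K) (u v : M) :
  iter i phi (a *: u + v) = a *: iter i phi u + iter i phi v.
Proof. by elim: i => //= i ->; rewrite linearP. Qed.

Lemma iter_phi0 i : iter i phi 0 = 0.
Proof. by elim: i => //= i ->; rewrite linear0. Qed.

Lemma poly_scaleDr p : {morph poly_scale p : u v / u + v}.
Proof.
move=> u v; rewrite /poly_scale -big_split /=; apply: eq_bigr => i _.
by have := iter_phi_lin i 1 u v; rewrite !scale1r => ->; rewrite scalerDr.
Qed.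

Lemma poly_scale_monom c k v :
  poly_scale (c *: 'X^k) v = c *: iter k phi v.
Proof.
have le : (size (c *: 'X^k) <= k.+1)%N.
  by rewrite (leq_trans (size_scale_leq _ _)) // size_polyXn.
rewrite (poly_scale_widen _ le) big_ord_recr /= big1 => [|i _].
  by rewrite add0r coefZ coefXn eqxx mulr1.
by rewrite coefZ coefXn ltn_eqF // mulr0 scale0r.
Qed.

Lemma poly_scale0 v : poly_scale 0 v = 0.
Proof. by rewrite /poly_scale size_poly0 big_ord0. Qed.

Lemma poly_scaler0 p : poly_scale p 0 = 0.
Proof. by rewrite /poly_scale big1 // => i _; rewrite iter_phi0 scaler0. Qed.

Lemma poly_scaleA p q v : poly_scale p (poly_scale q v) = poly_scale (p * q) v.
Proof.
pose P r := forall v, poly_scale p (poly_scale r v) = poly_scale (p * r) v.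
suff : P q by apply.
have P0 : P 0 by move=> u; rewrite mulr0 !poly_scale0 poly_scaler0.
have PD r s : P r -> P s -> P (r + s).
  by move=> Pr Ps u; rewrite poly_scaleDl poly_scaleDr Pr Ps mulrDr poly_scaleDl.
rewrite -[q]coefK poly_def; apply: (big_ind P) => // i _ u.
rewrite poly_scale_monom; move: (i : nat) (q`_i) => k c.
rewrite -[p]coefK poly_def mulr_suml.
pose Q r := poly_scale r (c *: iter k phi u) = poly_scale (r * (c *: 'X^k)) u.
suff : Q (\sum_(i < size p) p`_i *: 'X^i) by rewrite /Q mulr_suml.
apply: (big_ind Q) => [|r s Qr Qs|j _].
- by rewrite /Q mul0r !poly_scale0.
- by rewrite /Q mulrDl !poly_scaleDl Qr Qs.
rewrite /Q -scalerAl -scalerAr scalerA -exprD !poly_scale_monom iterD.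
have := iter_phi_lin j c (iter k phi u) 0; rewrite !addr0 iter_phi0 addr0 => ->.
by rewrite scalerA.
Qed.

Lemma poly_scale1 v : poly_scale 1 v = v.
Proof. by have := poly_scale_monom 1 0 v; rewrite scale1r expr0 scale1r. Qed.

HB.instance Definition _ := GRing.Zmodule_isLmodule.Build {poly K} (poly_module phi)
  poly_scaleA poly_scale1 poly_scaleDr poly_scaleDl.

Lemma poly_moduleZXn c k (v : poly_module phi) :
  (c *: 'X^k) *: v = (c *: iter k phi v : M).
Proof. exact: poly_scale_monom. Qed.

Lemma poly_moduleX (v : poly_module phi) : 'X *: v = phi v.
Proof. by have := poly_moduleZXn 1 1 v; rewrite !scale1r expr1. Qed.

Lemma poly_moduleC c (v : poly_module phi) : c%:P *: v = (c *: (v : M) : M).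
Proof. by have := poly_moduleZXn c 0 v; rewrite expr0 alg_polyC. Qed.

(** This makes the construction iterable: an endomorphism commuting with [phi]
    becomes the action of a second variable. *)
Lemma poly_module_linear (psi : {linear M -> M}) :
  (forall v, psi (phi v) = phi (psi v)) ->
  linear (psi : poly_module phi -> poly_module phi).
Proof.
move=> cm p u v; rewrite [LHS](linearD psi); congr (_ + _).
have cmi k w : psi (iter k phi w) = iter k phi (psi w).
  by elim: k => //= k IH; rewrite cm IH.
by rewrite [LHS]linear_sum; apply: eq_bigr => i _; rewrite linearZ /= cmi.
Qed.
End PolyModule.

(** Commuting endomorphisms [pd j], thought of as partial derivatives, turn a
    vector space into a module over the polynomials in two variables. *)
Section ConstantCoefficients.
Variables (F : numFieldType) (V : lmodType F) (m : nat).
Variable pd : 'I_m.+1 -> {linear V -> V}.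
Hypothesis pdC : forall j k v, pd j (pd k v) = pd k (pd j v).
Local Notation S := {poly {poly F}}.

Definition tlap (v : V) : V :=
  \sum_(j < m) pd (lift ord_max j) (pd (lift ord_max j) v).

Lemma tlap_is_linear : linear tlap.
Proof.
move=> a u v; rewrite /tlap scaler_sumr -big_split /=.
by apply: eq_bigr => j _; rewrite !linearP.
Qed.
HB.instance Definition _ := GRing.isLinear.Build F V V _ tlap tlap_is_linear.

Lemma pd_tlap j v : pd j (tlap v) = tlap (pd j v).
Proof.
by rewrite linear_sum; apply: eq_bigr => k _; rewrite /= pdC [X in pd _ X]pdC.
Qed.

Definition tmodule := poly_module tlap.
(** [pd j] again, as a map linear over the polynomials in [t]. *)
Definition pdT j : tmodule -> tmodule := pd j.
HB.instance Definition _ j := GRing.isLinear.Build {poly F} tmodule tmodule _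
  (pdT j) (poly_module_linear (pd_tlap j)).

Definition tymodule := poly_module (pdT ord_max).
Lemma pdTC j v : pdT j (pdT ord_max v) = pdT ord_max (pdT j v).
Proof. exact: pdC. Qed.
(** [pd j] again, as a map linear over the polynomials in [t] and [y]. *)
Definition pdS j : tymodule -> tymodule := pd j.
HB.instance Definition _ j := GRing.isLinear.Build {poly {poly F}} tymodule tymodule _
  (pdS j) (poly_module_linear (pdTC j)).

Lemma pdSC j k v : pdS j (pdS k v) = pdS k (pdS j v).
Proof. exact: pdC. Qed.

Lemma tyX (v : tymodule) : 'X *: v = pd ord_max v.
Proof. exact: poly_moduleX. Qed.
Lemma tyC (c : F) (v : tymodule) : c%:P%:P *: v = (c *: (v : V) : V).
Proof. by rewrite [LHS]poly_moduleC [LHS]poly_moduleC. Qed.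
Lemma tyY (v : tymodule) : 'X%:P *: v = tlap v.
Proof. by rewrite [LHS]poly_moduleC [LHS]poly_moduleX. Qed.
Lemma tyZXX (c : F) i j (v : tymodule) :
  ((c *: 'X^i) *: 'X^j) *: v = (c *: iter i tlap (iter j (pd ord_max) v) : V).
Proof. by rewrite [LHS]poly_moduleZXn [LHS]poly_moduleZXn. Qed.

Lemma ty_laplacian (v : tymodule) :
  \sum_(j < m.+1) pdS j (pdS j v) = ('X%:P + 'X ^+ 2) *: v.
Proof.
rewrite scalerDl expr2 -scalerA !tyX tyY (bigD1_ord ord_max) //= addrC.
by congr (_ + _ : V); apply: eq_bigr.
Qed.
End ConstantCoefficients.

(** * Exterior calculus with coefficients in a module *)

Section ExteriorAlgebra.
Variables (F : numFieldType) (n : nat).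
Local Notation S := {poly {poly F}}.
Variable (W : lmodType S).
Local Notation form := {ffun {set 'I_n} -> W}.
Implicit Types (j k : 'I_n) (I J : {set 'I_n}) (w : form).

(** The sign of [dx_j /\ dx_I], as a scalar of the module of coefficients. *)
Definition fsign j I : S := (-1) ^+ #|[set k in I | (k < j)%N]|.
(** The factor by which the sign of [dx_j /\ _] changes when [dx_k] is added. *)
Definition swap_sign j k : S := if (k < j)%N then -1 else 1.

Lemma fsignU j k I : k \notin I -> fsign j (k |: I) = swap_sign j k * fsign j I.
Proof.
move=> kI; rewrite /fsign /swap_sign; case: ifP => kj.
  have -> : [set x in k |: I | (x < j)%N] = k |: [set x in I | (x < j)%N].
    by apply/finset.setP=> x; rewrite !inE; case: eqP => // ->.
  by rewrite cardsU1 !inE (negbTE kI) exprD expr1.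
rewrite mul1r; congr (_ ^+ #|pred_of_set _|); apply/finset.setP=> x; rewrite !inE.
by case: eqP => // ->; rewrite (negbTE kI) kj.
Qed.

Lemma swap_signC j k : j != k -> swap_sign j k = - swap_sign k j.
Proof.
rewrite /swap_sign; case: ltngtP => [_ _|_ _|/val_inj->]; rewrite ?opprK ?eqxx //.
Qed.

Lemma fsign_sq j I : fsign j I * fsign j I = 1.
Proof. by rewrite -expr2 sqrr_sign. Qed.

Lemma swap_sign_sq j k : swap_sign j k * swap_sign j k = 1.
Proof. by rewrite /swap_sign; case: ifP; rewrite ?mulrNN mulr1. Qed.

Definition wedge_dx j w : form :=
  [ffun J : {set 'I_n} => if j \in J then fsign j (J :\ j) *: w (J :\ j) else 0].
Definition contract_dx j w : form :=
  [ffun I : {set 'I_n} => if j \in I then 0 else fsign j I *: w (j |: I)].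

Lemma wedge_dx_is_linear j : linear (wedge_dx j).
Proof.
move=> a u v; apply/ffunP => J; rewrite !ffunE; case: ifP => _.
  by rewrite scalerDr !scalerA [_ * a]mulrC.
by rewrite scaler0 addr0.
Qed.
HB.instance Definition _ j :=
  GRing.isLinear.Build S form form _ (wedge_dx j) (wedge_dx_is_linear j).

Lemma contract_dx_is_linear j : linear (contract_dx j).
Proof.
move=> a u v; apply/ffunP => J; rewrite !ffunE; case: ifP => _.
  by rewrite scaler0 addr0.
by rewrite scalerDr !scalerA [_ * a]mulrC.
Qed.
HB.instance Definition _ j :=
  GRing.isLinear.Build S form form _ (contract_dx j) (contract_dx_is_linear j).

(** With [I] a set containing neither [j] nor [k], every sign that occurs in this
    and the next two relations is a product of [fsign j I], [fsign k I] and swap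
    signs; the relations then reduce to [swap_signC]. *)
Lemma wedge_dx_anti j k w :
  wedge_dx j (wedge_dx k w) = - wedge_dx k (wedge_dx j w).
Proof.
have [->|jk] := eqVneq j k.
  apply/ffunP => J; rewrite !ffunE !inE eqxx /=.
  by case: ifP => _; rewrite ?scaler0 oppr0.
apply/ffunP => J; rewrite !ffunE !inE jk (eq_sym k) jk /=.
case: (boolP (j \in J)) => jJ; case: (boolP (k \in J)) => kJ;
  rewrite ?scaler0 ?oppr0 //.
pose I := J :\ j :\ k.
have jI : j \notin I by rewrite !inE eqxx andbF.
have kI : k \notin I by rewrite !inE eqxx.
have eI : J :\ k :\ j = I by rewrite /I !finset.setDDl finset.setUC.
rewrite eI.
have -> : J :\ j = k |: I by rewrite finset.setD1K // !inE eq_sym jk.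
have -> : J :\ k = j |: I by rewrite -eI finset.setD1K // !inE jk.
rewrite !finset.setU1K // !fsignU // !scalerA (swap_signC jk) -scaleNr; congr (_ *: _).
by ring.
Qed.

Lemma contract_dx_anti j k w :
  contract_dx j (contract_dx k w) = - contract_dx k (contract_dx j w).
Proof.
have [->|jk] := eqVneq j k.
  apply/ffunP => J; rewrite !ffunE !inE eqxx /=.
  by case: ifP => _; rewrite ?scaler0 oppr0.
apply/ffunP => I; rewrite !ffunE !inE (negbTE jk) (eq_sym k) (negbTE jk) /=.
case: (boolP (j \in I)) => jI; case: (boolP (k \in I)) => kI;
  rewrite ?scaler0 ?oppr0 //.
rewrite !fsignU // finset.setUCA !scalerA (swap_signC jk) -scaleNr; congr (_ *: _).
by ring.
Qed.

Lemma wedge_contract j k w :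
  wedge_dx j (contract_dx k w) + contract_dx k (wedge_dx j w) = if j == k then w else 0.
Proof.
have [->|jk] := eqVneq j k; apply/ffunP => J; rewrite !ffunE !inE ?eqxx /=.
  case: (boolP (k \in J)) => kJ.
    by rewrite finset.setD1K // scalerA fsign_sq scale1r addr0.
  by rewrite finset.setU1K // scalerA fsign_sq scale1r add0r.
rewrite (negbTE jk) (eq_sym k) jk /=.
case: (boolP (j \in J)) => jJ; case: (boolP (k \in J)) => kJ;
  rewrite ?scaler0 ?addr0 //.
pose I := J :\ j; have jI : j \notin I by rewrite !inE eqxx.
have kI : k \notin I by rewrite !inE (negbTE kJ) andbF.
have -> : k |: J = j |: (k |: I) by rewrite finset.setUCA finset.setD1K.
rewrite finset.setU1K; last by rewrite !inE negb_or jk eqxx.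
have -> : fsign k J = fsign k (j |: I) by rewrite finset.setD1K.
rewrite -/I !fsignU // !scalerA.
rewrite -scalerDl (swap_signC jk) [X in X *: _](_ : _ = 0) ?scale0r //.
have := swap_sign_sq k j; set s := swap_sign k j => ss.
transitivity (fsign j I * fsign k I * (1 - s * s)); first by ring.
by rewrite ss subrr mulr0.
Qed.

Variable pd : 'I_n -> {linear W -> W}.
Hypothesis pdC : forall j k v, pd j (pd k v) = pd k (pd j v).

Definition on_coefs j w : form := [ffun I : {set 'I_n} => pd j (w I)].

Lemma on_coefs_is_linear j : linear (on_coefs j).
Proof. by move=> a u v; apply/ffunP => J; rewrite !ffunE linearP. Qed.
HB.instance Definition _ j :=
  GRing.isLinear.Build S form form _ (on_coefs j) (on_coefs_is_linear j).

Lemma on_coefsC j k w : on_coefs j (on_coefs k w) = on_coefs k (on_coefs j w).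
Proof. by apply/ffunP => J; rewrite !ffunE pdC. Qed.

Lemma on_coefs_wedge j k w : on_coefs j (wedge_dx k w) = wedge_dx k (on_coefs j w).
Proof.
by apply/ffunP => J; rewrite !ffunE; case: ifP => _; rewrite ?linearZ ?linear0.
Qed.

Lemma on_coefs_contract j k w :
  on_coefs j (contract_dx k w) = contract_dx k (on_coefs j w).
Proof.
by apply/ffunP => J; rewrite !ffunE; case: ifP => _; rewrite ?linearZ ?linear0.
Qed.

Definition extd w : form := \sum_j wedge_dx j (on_coefs j w).
Definition extde w : form := - \sum_j contract_dx j (on_coefs j w).

Lemma extdeE w : extde w = \sum_j - contract_dx j (on_coefs j w).
Proof. by rewrite sumrN. Qed.

Lemma extd_is_linear : linear extd.
Proof.
move=> a u v; rewrite /extd scaler_sumr -big_split.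
by apply: eq_bigr => j _; rewrite !linearP.
Qed.
HB.instance Definition _ := GRing.isLinear.Build S form form _ extd extd_is_linear.

Lemma extde_is_linear : linear extde.
Proof.
move=> a u v; rewrite /extde scalerN -opprD scaler_sumr -big_split; congr (- _).
by apply: eq_bigr => j _; rewrite !linearP.
Qed.
HB.instance Definition _ := GRing.isLinear.Build S form form _ extde extde_is_linear.

Lemma anti_sum (A : 'I_n -> 'I_n -> form) : (forall j k, A j k = - A k j) ->
  \sum_j \sum_k A j k = 0.
Proof.
move=> anti; set X := (LHS).
have e : X = - X.
  rewrite {1}/X exchange_big -sumrN; apply: eq_bigr => j _; rewrite -sumrN.
  by apply: eq_bigr => k _; rewrite anti.
have : 2%:R *: X = 0 by rewrite scaler_nat mulr2n {2}e subrr.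
move=> /(congr1 (fun x => (2%:R^-1 : F)%:P%:P *: x)); rewrite scaler0 scalerA.
by rewrite -!polyC_natr -!polyCM mulVf ?pnatr_eq0 // scale1r.
Qed.

(** Contraction of the antisymmetric wedge products with the symmetric second
    derivatives. *)
Lemma extd_extd w : extd (extd w) = 0.
Proof.
transitivity (\sum_j \sum_k
    wedge_dx j (wedge_dx k (on_coefs j (on_coefs k w)))).
  rewrite /extd; apply: eq_bigr => j _; rewrite !linear_sum.
  by apply: eq_bigr => k _; rewrite /= on_coefs_wedge.
by apply: anti_sum => j k; rewrite wedge_dx_anti on_coefsC.
Qed.

Lemma extde_extde w : extde (extde w) = 0.
Proof.
transitivity (\sum_j \sum_k
    contract_dx j (contract_dx k (on_coefs j (on_coefs k w)))).
  rewrite /extde -sumrN; apply: eq_bigr => j _; rewrite !linearN opprK.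
  by rewrite !linear_sum; apply: eq_bigr => k _; rewrite /= on_coefs_contract.
by apply: anti_sum => j k; rewrite contract_dx_anti on_coefsC.
Qed.

(** Cartan's formula for a coordinate field. *)
Lemma extd_contract k w :
  extd (contract_dx k w) + contract_dx k (extd w) = on_coefs k w.
Proof.
rewrite /extd linear_sum -big_split (bigD1 k) //= big1 => [|j jk].
  by rewrite on_coefs_contract wedge_contract eqxx addr0.
by rewrite on_coefs_contract wedge_contract (negbTE jk).
Qed.

Lemma extde_contract k w :
  extde (contract_dx k w) + contract_dx k (extde w) = 0.
Proof.
have -> : contract_dx k (extde w) = - \sum_j contract_dx k (contract_dx j (on_coefs j w)).
  by rewrite /extde linearN; congr (- _); exact: linear_sum.
rewrite /extde -opprD -big_split big1 ?oppr0 // => j _ /=.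
by rewrite on_coefs_contract contract_dx_anti addNr.
Qed.

(** In the sum over [j] and [k] of second derivatives, the anticommutator of
    [dx_j /\ _] with the contraction by the [k]th field selects [j = k]. *)
Lemma extd_extde w :
  extd (extde w) + extde (extd w) = - \sum_j on_coefs j (on_coefs j w).
Proof.
have -> : extd (extde w) = - \sum_j extd (contract_dx j (on_coefs j w)).
  by rewrite /extde linearN; congr (- _); exact: linear_sum.
rewrite /extde -opprD; congr (- _).
rewrite -big_split; apply: eq_bigr => k _ /=.
rewrite /extd linear_sum /= [X in _ + contract_dx k X](_ : _ =
    \sum_j wedge_dx j (on_coefs j (on_coefs k w))).
  rewrite linear_sum -big_split (bigD1 k) //= big1 => [|j jk].
    by rewrite on_coefs_contract wedge_contract eqxx addr0.
  by rewrite on_coefs_contract wedge_contract (negbTE jk).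
by apply: eq_bigr => j _; rewrite on_coefs_wedge on_coefsC.
Qed.

Variables (D : S) (k : 'I_n).
Hypothesis pdD : forall v, \sum_j pd j (pd j v) = D *: v.
Hypothesis pdX : forall v, pd k v = 'X *: v.

Lemma extd_extde_laplacian w :
  extd (extde w) + extde (extd w) = - (D *: w).
Proof.
rewrite extd_extde; congr (- _); apply/ffunP => I.
rewrite sum_ffunE [RHS]ffunE -pdD; apply: eq_bigr => j _.
by rewrite !ffunE.
Qed.

Lemma extd_contractX w :
  extd (contract_dx k w) + contract_dx k (extd w) = 'X *: w.
Proof. by rewrite extd_contract; apply/ffunP => I; rewrite !ffunE pdX. Qed.
End ExteriorAlgebra.

(** * Symmetry of second derivatives *)

Lemma dist_le_halves (R : realType) (a b q e : R) :
  `|a - q| < e / 2 -> `|b - q| < e / 2 -> `|a - b| <= e.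
Proof.
move=> /ltW aq /ltW bq; apply: (le_trans (ler_distD q _ _)).
by rewrite (splitr e); apply: lerD => //; rewrite distrC.
Qed.

Section MixedPartials.
Variables (R : realType) (n : nat).
Implicit Types (f g : 'rV[R]_n -> R) (x u v : 'rV[R]_n).

Lemma is_derive_line f x v (s : R) : derivable f (x + s *: v) v ->
  is_derive s 1 (fun r => f (x + r *: v)) ('D_v f (x + s *: v)).
Proof.
have e : (fun h : R => h^-1 *: (f (x + (h *: 1 + s) *: v) - f (x + s *: v)))
   = (fun h : R => h^-1 *: (f (h *: v + (x + s *: v)) - f (x + s *: v))).
  by apply/funext => h; rewrite [h *: 1]mulr1 scalerDl addrCA.
move=> df; split; first by rewrite /derivable e.
by rewrite /derive e.
Qed.

Lemma mvt_line f x v (h : R) : 0 < h -> (forall y, derivable f y v) ->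
  exists2 s, 0 < s < h & f (x + h *: v) - f x = h * 'D_v f (x + s *: v).
Proof.
move=> h0 df; have dl s := is_derive_line (df (x + s *: v)).
have cl : {within `[0, h], continuous (fun r => f (x + r *: v))}.
  by apply: derivable_within_continuous => s _; have [] := dl s.
have [s /[!in_itv]/= sh e] := MVT h0 (fun s _ => dl s) cl.
exists s => //; move: e; rewrite subr0 scale0r addr0 => ->.
by rewrite mulrC.
Qed.

(** The mean value theorem is applied twice: along [v] to the increment of [f] in
    the direction [u], then along [u] to ['D_v f]. *)
Lemma second_difference f x u v (h : R) : 0 < h ->
  (forall y, derivable f y v) -> (forall y, derivable ('D_v f) y u) ->
  exists s t, [/\ 0 < s < h, 0 < t < h &
    f (x + h *: v + h *: u) - f (x + h *: v) - (f (x + h *: u) - f x) =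
    h * (h * 'D_u ('D_v f) (x + s *: v + t *: u))].
Proof.
move=> h0 df ddf; pose g := (fun y => f (y + h *: u)) - f.
have sh y : derivable (fun z => f (z + h *: u)) y v /\
    'D_v (fun z => f (z + h *: u)) y = 'D_v f (y + h *: u).
  have e : (fun r : R => r^-1 *: (f (r *: v + y + h *: u) - f (y + h *: u)))
     = (fun r : R => r^-1 *: (f (r *: v + (y + h *: u)) - f (y + h *: u))).
    by apply/funext => r; rewrite addrA.
  by split; [rewrite /derivable e; exact: df | rewrite /derive e].
have dg y : derivable g y v by apply: derivableB; [exact: (sh y).1|exact: df].
have [s sh' e] := mvt_line x h0 dg.
have [t th e'] := mvt_line (x + s *: v) h0 ddf.
exists s, t; split=> //; rewrite -e' -[RHS]/(h * (_ - _)).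
have <- : 'D_v g (x + s *: v) = 'D_v f (x + s *: v + h *: u) - 'D_v f (x + s *: v).
  by rewrite deriveB ?(sh _).2 //; exact: (sh _).1.
by rewrite -e /g !fctE addrAC.
Qed.

(** The second difference is symmetric in [u] and [v], so the two mixed derivatives
    agree at some points of every small parallelogram based at [x]; by
    continuity they agree at [x]. *)
Lemma derive_comm f x u v :
  (forall y, derivable f y v) -> (forall y, derivable f y u) ->
  (forall y, derivable ('D_v f) y u) -> (forall y, derivable ('D_u f) y v) ->
  continuous ('D_u ('D_v f)) -> continuous ('D_v ('D_u f)) ->
  'D_u ('D_v f) x = 'D_v ('D_u f) x.
Proof.
move=> dv du duv dvu cuv cvu; apply/eqP; rewrite -subr_eq0 -normr_le0.
apply/ler_addgt0Pl => e e0; rewrite addr0.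
have e2 : 0 < e / 2 by rewrite divr_gt0.
have /cvgrPdist_lt/(_ _ e2)/nbhs_ballP[d1 /= d10 h1] := cuv x.
have /cvgrPdist_lt/(_ _ e2)/nbhs_ballP[d2 /= d20 h2] := cvu x.
pose d := Num.min d1 d2; have d0 : 0 < d by rewrite lt_min d10 d20.
(* The term 1 makes [c] positive when [u] and [v] vanish; for [h = d / c] the whole
   parallelogram lies in the ball of radius [d]. *)
pose c := `|u| + `|v| + 1.
have c0 : 0 < c by rewrite ltr_wpDl // addr_ge0.
pose h := d / c; have h0 : 0 < h by rewrite divr_gt0.
have near (p q : 'rV[R]_n) (s t : R) : `|p| + `|q| + 1 = c -> 0 < s < h -> 0 < t < h ->
    ball x d (x + s *: p + t *: q).
  move=> pq /andP[s0 sh] /andP[t0 th]; rewrite -ball_normE /ball_ /=.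
  rewrite -addrA opprD addNKr normrN (le_lt_trans (ler_normD _ _)) // !normrZ.
  rewrite !gtr0_norm //.
  have -> : d = h * c by rewrite /h divfK // gt_eqF.
  rewrite -pq !mulrDr mulr1; apply: (@le_lt_trans _ _ (h * `|p| + h * `|q|)).
    by apply: lerD; apply: ler_wpM2r; rewrite ?normr_ge0 //; apply: ltW.
  by rewrite ltrDl.
have [s [t [sh th e1]]] := second_difference x h0 dv duv.
have [s' [t' [sh' th' e2']]] := second_difference x h0 du dvu.
have eq : 'D_u ('D_v f) (x + s *: v + t *: u) =
    'D_v ('D_u f) (x + s' *: u + t' *: v).
  apply: (mulfI (lt0r_neq0 h0)); apply: (mulfI (lt0r_neq0 h0)).
  apply: (etrans (esym e1)); apply: etrans e2'; rewrite [x + h *: u + _]addrAC.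
  move: (f (x + h *: v + h *: u)) (f (x + h *: v)) (f (x + h *: u)) (f x).
  by move=> A B C E; ring.
have dd1 : d <= d1 by rewrite ge_min lexx.
have dd2 : d <= d2 by rewrite ge_min lexx orbT.
have cC : `|v| + `|u| + 1 = c by rewrite [`|v| + _]addrC.
have n1 := h1 _ (le_ball dd1 (near v u s t cC sh th)).
have n2 := h2 _ (le_ball dd2 (near u v s' t' erefl sh' th')).
by move: n1 => /=; rewrite eq => n1; exact: dist_le_halves n1 n2.
Qed.

Lemma rpartial_comm f (j k : 'I_n) : rsmooth f ->
  rpartial j (rpartial k f) = rpartial k (rpartial j f).
Proof.
move=> sf; apply/funext => x; apply: derive_comm.
- exact: (sf [::]).2.
- exact: (sf [::]).2.
- exact: (sf [:: k]).2.
- exact: (sf [:: j]).2.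
- exact: (sf [:: j; k]).1.
- exact: (sf [:: k; j]).1.
Qed.

End MixedPartials.

(** * The module of smooth functions *)

Section SmoothFunctions.
Variables (R : realType) (n : nat).
Local Notation C := R[i].

Lemma rsmooth_iter_lin (a : R) (f g : 'rV[R]_n -> R) s :
  rsmooth f -> rsmooth g ->
  foldr (@rpartial R n) (a *: f + g) s =
  a *: foldr (@rpartial R n) f s + foldr (@rpartial R n) g s.
Proof.
move=> sf sg; elim: s => [//|j s IH] /=; rewrite IH; apply/funext => x.
have df := (sf s).2 j x; have dg := (sg s).2 j x.
by rewrite /rpartial (deriveD (derivableZ df) dg) (deriveZ _ df).
Qed.

Lemma rsmooth_lin (a : R) (f g : 'rV[R]_n -> R) :
  rsmooth f -> rsmooth g -> rsmooth (a *: f + g).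
Proof.
move=> sf sg s /=; rewrite rsmooth_iter_lin //.
have [cf df] := sf s; have [cg dg] := sg s; split=> [x|j x].
  exact: (cvgD (cvgM (cvg_cst a) (cf x)) (cg x)).
by apply: derivableD; [apply: derivableZ; exact: df | exact: dg].
Qed.

Lemma rpartial_lin (a : R) (f g : 'rV[R]_n -> R) j :
  rsmooth f -> rsmooth g ->
  rpartial j (a *: f + g) = a *: rpartial j f + rpartial j g.
Proof. by move=> sf sg; have := rsmooth_iter_lin a [:: j] sf sg. Qed.

Lemma rsmooth_rpartial (f : 'rV[R]_n -> R) j : rsmooth f -> rsmooth (rpartial j f).
Proof. by move=> sf s; have := sf (rcons s j); rewrite /= foldr_rcons. Qed.

Lemma rsmooth0 : rsmooth (0 : 'rV[R]_n -> R).
Proof.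
move=> s /=; have -> : foldr (@rpartial R n) 0 s = 0.
  elim: s => [//|j s /= ->]; apply/funext => x; exact: derive_cst.
by split=> [x|j x]; [exact: cst_continuous | exact: derivable_cst].
Qed.

Local Notation reF f := (fun x => complex.Re (f x)).
Local Notation imF f := (fun x => complex.Im (f x)).

Lemma Re_lin (a : C) (f g : 'rV[R]_n -> C) :
  reF (fun x => a * f x + g x) =
  complex.Re a *: reF f + ((- complex.Im a) *: imF f + reF g).
Proof.
apply/funext => x; rewrite !fctE; case: a (f x) (g x) => [? ?] [? ?] [? ?] /=.
rewrite /GRing.scale /=; ring.
Qed.

Lemma Im_lin (a : C) (f g : 'rV[R]_n -> C) :
  imF (fun x => a * f x + g x) =
  complex.Re a *: imF f + (complex.Im a *: reF f + imF g).
Proof.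
apply/funext => x; rewrite !fctE; case: a (f x) (g x) => [? ?] [? ?] [? ?] /=.
rewrite /GRing.scale /=; ring.
Qed.

Lemma smooth_lin (a : C) (f g : 'rV[R]_n -> C) :
  smooth f -> smooth g -> smooth (fun x => a * f x + g x).
Proof.
move=> [rf jf] [rg jg]; split.
  by rewrite Re_lin; do 2?apply: rsmooth_lin.
by rewrite Im_lin; do 2?apply: rsmooth_lin.
Qed.

Lemma partial_lin (a : C) (f g : 'rV[R]_n -> C) j :
  smooth f -> smooth g ->
  partial j (fun x => a * f x + g x) = fun x => a * partial j f x + partial j g x.
Proof.
move=> [rf jf] [rg jg].
have hr := rpartial_lin (complex.Re a) j rf (rsmooth_lin (- complex.Im a) jf rg).
have hi := rpartial_lin (complex.Re a) j jf (rsmooth_lin (complex.Im a) rf jg).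
rewrite (rpartial_lin _ _ jf rg) -Re_lin in hr.
rewrite (rpartial_lin _ _ rf jg) -Im_lin in hi.
apply/funext => x; rewrite /partial hr hi !fctE /GRing.scale /=.
case: a {hr hi} => p q; apply/eqP.
by rewrite eq_complex /=; apply/andP; split; apply/eqP; ring.
Qed.

Lemma smooth_partial (f : 'rV[R]_n -> C) j : smooth f -> smooth (partial j f).
Proof. by move=> [rf jf]; split; exact: rsmooth_rpartial. Qed.

Lemma partial_comm (f : 'rV[R]_n -> C) j k : smooth f ->
  partial j (partial k f) = partial k (partial j f).
Proof.
move=> [rf jf]; apply/funext => x; apply: (f_equal2 (@Complex R)).
  exact: (congr1 (fun h => h x) (rpartial_comm j k rf)).
exact: (congr1 (fun h => h x) (rpartial_comm j k jf)).
Qed.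

Lemma smooth0 : smooth ((fun=> 0) : 'rV[R]_n -> C).
Proof. by split; exact: rsmooth0. Qed.

(** [R[i]^o] is R[i] as a module over itself. *)
Definition smoothb : {pred ('rV[R]_n -> R[i]^o)} := fun f => `[< smooth f >].

Lemma smooth_submod : submod_closed smoothb.
Proof.
split; first by apply/asboolP; exact: smooth0.
by move=> a f g /asboolP sf /asboolP sg; apply/asboolP; exact: smooth_lin.
Qed.

HB.instance Definition _ := GRing.isSubmodClosed.Build _ _ smoothb smooth_submod.

Record sfun := SFun { sfun_val :> 'rV[R]_n -> R[i]^o; _ : sfun_val \in smoothb }.
HB.instance Definition _ := [isSub for sfun_val].
HB.instance Definition _ := [Choice of sfun by <:].
HB.instance Definition _ := [SubChoice_isSubLmodule of sfun by <:].

Lemma sfun_smooth (f : sfun) : smooth f.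
Proof. by case: f => f /= /asboolP. Qed.

Definition mk_sfun (f : 'rV[R]_n -> R[i]) (sf : smooth f) : sfun :=
  @SFun f (introT (asboolP _) sf).

Definition dpart (j : 'I_n) (f : sfun) : sfun :=
  mk_sfun (smooth_partial j (sfun_smooth f)).

Lemma dpart_is_linear j : linear (dpart j).
Proof. by move=> a f g; apply/val_inj; apply: partial_lin; exact: sfun_smooth. Qed.
HB.instance Definition _ j :=
  GRing.isLinear.Build R[i] sfun sfun _ (dpart j) (dpart_is_linear j).

Lemma dpartC j k f : dpart j (dpart k f) = dpart k (dpart j f).
Proof. by apply/val_inj; apply: partial_comm; exact: sfun_smooth. Qed.
End SmoothFunctions.

(** * Transfer to differential forms *)

(** The passage from a module to differential forms, for any module equipped with
    maps matching the operators on forms.  Keeping the module abstract separates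
    the bookkeeping of scalars from the concrete layers of structure on smooth
    forms. *)
Section FormModel.
Variables (R : realType) (m : nat).
Local Notation C := R[i].
Local Notation S := {poly {poly C}}.
Variables (M : lmodType S) (d de io : {linear M -> M}).
Hypothesis dd : forall w, d (d w) = 0.
Hypothesis dede : forall w, de (de w) = 0.
Hypothesis dio : forall w, d (io w) + io (d w) = 'X *: w.
Hypothesis deio : forall w, de (io w) + io (de w) = 0.
Hypothesis lap : forall w, d (de w) + de (d w) = - (('X%:P + 'X ^+ 2) *: w).
Variable form_of : M -> diff_form R m.+1.
Hypothesis form_ofD : forall v w, form_of (v + w) = fadd (form_of v) (form_of w).
Hypothesis form_ofZ : forall c w, form_of (c%:P%:P *: w) = fscale c (form_of w).
Hypothesis ext_d_form : forall w, ext_d (form_of w) = form_of (d w).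
Hypothesis codiff_form : forall w, codifferential (form_of w) = form_of (de w).
Hypothesis interior_form : forall w,
  interior_mult ord_max (form_of w) = form_of (io w).
Hypothesis juhl_form : forall mu b w,
  juhl mu b (form_of w) = form_of (juhl_polyz mu b *: w).

Lemma hodge_form (w : M) :
  hodge_laplacian (form_of w) = form_of (('X%:P + 'X ^+ 2) *: w).
Proof.
rewrite /hodge_laplacian codiff_form !ext_d_form codiff_form -form_ofD -form_ofZ.
by rewrite (opp_anticommutator lap).
Qed.

Lemma iter_hodge_form k (w : M) :
  iter k (@hodge_laplacian R m.+1) (form_of w) =
  form_of (('X%:P + 'X ^+ 2) ^+ k *: w).
Proof.
elim: k => [|k /= ->]; first by rewrite expr0 scale1r.
by rewrite hodge_form scalerA -exprS.
Qed.

Lemma branson_form i l (w : M) :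
  branson i l.+1 (form_of w) = form_of (branson_op d de
    (m.+1%:R / 2 - i%:R - l.+1%:R) (m.+1%:R / 2 - i%:R + l.+1%:R) l w).
Proof.
rewrite /branson iter_hodge_form codiff_form !ext_d_form codiff_form.
by rewrite -!form_ofZ -form_ofD.
Qed.

Lemma sbo_down_form i (u : C) a (w : M) :
  sbo_down i u a (form_of w) =
  Rest (form_of (down_op d de io
    (mu_of m i u) ((u + 2 * i%:R - m.+1%:R) / 2) a w)).
Proof.
rewrite /sbo_down interior_form !codiff_form ext_d_form !juhl_form.
by rewrite -!form_ofZ -!form_ofD.
Qed.

Lemma sbo_same_form i (u : C) a (w : M) :
  sbo_same i u a (form_of w) =
  Rest (form_of (same_op d de io
    (mu_of m i u) ((u + a%:R) / 2) a w)).
Proof.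
rewrite /sbo_same interior_form codiff_form !ext_d_form !juhl_form.
by rewrite -!form_ofZ -!form_ofD.
Qed.

Lemma RestZ (c : C) (w : diff_form R m.+1) : Rest (fscale c w) = fscale c (Rest w).
Proof. by []. Qed.

Lemma mu_ofE i (s : C) : mu_of m i (m.+1%:R / 2 - i%:R + s) = s + 1 / 2.
Proof. by rewrite /mu_of -natr1; field. Qed.

(** The factors [(u + 2 i - n) / 2] are [- c / 2] on the left and [- e / 2] on the
    right, whereas [(u + a) / 2] is the same on both sides: [c + 2 (l + 1) = e]. *)
Lemma model_factorization i a l (w : M)
    (c := m.+1%:R / 2 - i%:R - l.+1%:R) (e := m.+1%:R / 2 - i%:R + l.+1%:R) :
  sbo_down i e a (branson i l.+1 (form_of w)) =
    fscale (- c * (K_coef l.+1 a)%:R) (sbo_down i c (a + 2 * l.+1) (form_of w)) /\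
  sbo_same i e a (branson i l.+1 (form_of w)) =
    fscale (- e * (K_coef l.+1 a)%:R) (sbo_same i c (a + 2 * l.+1) (form_of w)).
Proof.
have ec : e - c = 2 * l.+1%:R by rewrite /e /c; ring.
have mu_e : mu_of m i e = l.+1%:R + 1 / 2 by exact: mu_ofE.
have mu_c : mu_of m i c = - l.+1%:R + 1 / 2 by exact: mu_ofE.
rewrite branson_form !sbo_down_form !sbo_same_form mu_e mu_c; split.
  have -> : (e + 2 * i%:R - m.+1%:R) / 2 = - c / 2 by rewrite /e /c; field.
  have -> : (c + 2 * i%:R - m.+1%:R) / 2 = - e / 2 by rewrite /e /c; field.
  by rewrite (sbo_down_branson dede dio deio lap _ _ ec) form_ofZ RestZ.
have -> : (c + (a + 2 * l.+1)%:R) / 2 = (e + a%:R) / 2.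
  by rewrite /e /c natrD natrM; field.
by rewrite (sbo_same_branson dd dede dio deio lap _ _ ec) form_ofZ RestZ.
Qed.
End FormModel.

Section Transfer.
Variables (R : realType) (m : nat).
Local Notation C := R[i].
Local Notation S := {poly {poly C}}.
Local Notation V := (sfun R m.+1).

Definition sfun_partial (j : 'I_m.+1) : {linear V -> V} := @dpart R m.+1 j.
Lemma sfun_partialC j k (v : V) :
  sfun_partial j (sfun_partial k v) = sfun_partial k (sfun_partial j v).
Proof. exact: dpartC. Qed.

Local Notation W := (tymodule sfun_partialC).
Local Notation form := {ffun {set 'I_m.+1} -> W}.

Definition form_partial (j : 'I_m.+1) : {linear W -> W} :=
  pdS (pdC := sfun_partialC) j.

Lemma form_partialC j k (v : W) :
  form_partial j (form_partial k v) = form_partial k (form_partial j v).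
Proof. exact: pdSC. Qed.

Definition form_of (w : form) : diff_form R m.+1 := fun I => sfun_val (w I : V).

Lemma form_ofP (w : diff_form R m.+1) : (forall I, smooth (w I)) ->
  exists v, w = form_of v.
Proof.
move=> sw; exists [ffun I : {set 'I_m.+1} => mk_sfun (sw I) : W].
by apply/funext => I; rewrite /form_of ffunE.
Qed.

Lemma sfun_valD (u v : V) x : sfun_val (u + v) x = sfun_val u x + sfun_val v x.
Proof. by []. Qed.

Lemma sfun_valZ c (v : V) x : sfun_val (c *: v) x = c * sfun_val v x.
Proof. by []. Qed.

Lemma sfun_val_sum (I : Type) (r : seq I) (P : pred I) (G : I -> V) x :
  sfun_val (\sum_(i <- r | P i) G i) x = \sum_(i <- r | P i) sfun_val (G i) x.
Proof.
by elim/big_rec2: _ => [//|i y z _ <-]; rewrite sfun_valD.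
Qed.

Lemma form_ofD (u v : form) : form_of (u + v) = fadd (form_of u) (form_of v).
Proof. by apply/funext => I; apply/funext => x; rewrite /form_of ffunE sfun_valD. Qed.

Lemma form_ofZ c (v : form) : form_of (c%:P%:P *: v) = fscale c (form_of v).
Proof.
apply/funext => I; apply/funext => x; rewrite /form_of ffunE.
by rewrite [X in sfun_val X]tyC sfun_valZ.
Qed.

Lemma sign_val j (I : {set 'I_m.+1}) (v : W) x :
  sfun_val (fsign C j I *: v : V) x = wedge_sign R j I * sfun_val (v : V) x.
Proof.
rewrite /fsign /wedge_sign; move: #|_| => k.
have -> : (-1) ^+ k = ((-1) ^+ k)%:P%:P :> S by rewrite !rmorphXn !rmorphN !rmorph1.
by rewrite [X in sfun_val X]tyC sfun_valZ.
Qed.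

Lemma ext_d_form (w : form) :
  ext_d (form_of w) = form_of (extd form_partial w).
Proof.
apply/funext => J; apply/funext => x.
rewrite /form_of sum_ffunE [RHS]sfun_val_sum; apply: eq_bigr => j _.
rewrite !ffunE (bigD1 (J :\ j)) //= big1 ?addr0 /wedge_mx => [|I IJ].
  rewrite !inE eqxx /=; case: (boolP (j \in J)) => jJ.
    by rewrite finset.setD1K // eqxx sign_val.
  rewrite (_ : (J == _) = false) ?mul0r //.
  by apply/negbTE; apply: contraNneq jJ => ->; rewrite finset.setU11.
case: ifP => [/andP[jI /eqP JI]|]; last by rewrite mul0r.
by move: IJ; rewrite JI finset.setU1K // eqxx.
Qed.

Lemma codiff_form (w : form) :
  codifferential (form_of w) = form_of (extde form_partial w).
Proof.
apply/funext => I; apply/funext => x.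
rewrite extdeE /form_of sum_ffunE [RHS]sfun_val_sum; apply: eq_bigr => j _.
rewrite !ffunE (bigD1 (j |: I)) //= big1 ?addr0 /formal_adjoint1 /wedge_mx => [|J JI].
  rewrite eqxx andbT if_neg; case: ifPn => jI.
    by transitivity (- 0 : C) => //; rewrite conjC0 oppr0 mul0r.
  transitivity (- (wedge_sign R j I * partial j (form_of w (j |: I)) x)).
    by rewrite /wedge_sign rmorph_sign mulNr.
  by rewrite -[partial _ _ _]/(sfun_val (form_partial j (w (j |: I))) x) -sign_val.
case: ifP => [/andP[_ /eqP JI']|]; last by rewrite conjC0 oppr0 mul0r.
by move: JI; rewrite JI' eqxx.
Qed.

Lemma interior_form (w : form) :
  interior_mult ord_max (form_of w) = form_of (contract_dx ord_max w).
Proof.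
apply/funext => I; apply/funext => x; rewrite /form_of ffunE /interior_mult.
by case: ifP => _; rewrite ?sign_val.
Qed.

Lemma iter_partial_val k (v : V) :
  iter k (partial ord_max) v = iter k (sfun_partial ord_max) v :> ('rV[R]_m.+1 -> C).
Proof. by elim: k => //= k ->. Qed.

Lemma tlap_val (v : V) :
  @tangential_laplacian R m v = tlap sfun_partial v :> ('rV[R]_m.+1 -> C).
Proof. by apply/funext => x; rewrite [RHS]sfun_val_sum. Qed.

Lemma iter_tlap_val k (v : V) :
  iter k (@tangential_laplacian R m) v = iter k (tlap sfun_partial) v :> ('rV[R]_m.+1 -> C).
Proof. by elim: k => //= k ->; rewrite tlap_val. Qed.

Lemma juhl_form (mu : C) (b : int) (w : form) :
  juhl mu b (form_of w) = form_of (juhl_polyz mu b *: w).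
Proof.
case: b => b; last first.
  by apply/funext => I; apply/funext => x; rewrite /= scale0r /form_of ffunE.
apply/funext => I; apply/funext => x; rewrite /= /form_of ffunE juhl_poly_sum.
rewrite scaler_suml [RHS]sfun_val_sum /juhl_nat !big_nat.
apply: eq_bigr => k /andP[_ kb]; rewrite juhl_coefE //.
rewrite [X in _ = sfun_val X _]tyZXX sfun_valZ.
by rewrite iter_partial_val iter_tlap_val.
Qed.

Lemma form_laplacian (w : form) :
  extd form_partial (extde form_partial w)
    + extde form_partial (extd form_partial w) = - (('X%:P + 'X ^+ 2) *: w).
Proof.
exact: (extd_extde_laplacian form_partialC (@ty_laplacian _ _ _ _ sfun_partialC)).
Qed.

Lemma form_dio (w : form) :
  extd form_partial (contract_dx ord_max w)
    + contract_dx ord_max (extd form_partial w) = 'X *: w.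
Proof. by apply: extd_contractX => v; rewrite tyX. Qed.

End Transfer.

Theorem theorem1p9 (R : realType) (m : nat) :
  let n := m.+1 in
  (2 <= n)%N ->
  forall (i a l : nat), (i <= n)%N -> (1 <= l)%N ->
  (i != 0%N ->
   forall w : diff_form R n, is_form i w ->
   sbo_down i (n%:R / 2 - i%:R + l%:R) a (branson i l w) =
   fscale (- (n%:R / 2 - i%:R - l%:R) * (K_coef l a)%:R)
     (sbo_down i (n%:R / 2 - i%:R - l%:R) (a + 2 * l) w))
  /\
  (i != n ->
   forall w : diff_form R n, is_form i w ->
   sbo_same i (n%:R / 2 - i%:R + l%:R) a (branson i l w) =
   fscale (- (n%:R / 2 - i%:R + l%:R) * (K_coef l a)%:R)
     (sbo_same i (n%:R / 2 - i%:R - l%:R) (a + 2 * l) w)).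
Proof.
move=> n _ i a [//|l] _ _.
have model v := model_factorization
  (extd_extd (@form_partialC R m)) (extde_extde (@form_partialC R m))
  (@form_dio R m) (extde_contract (@form_partial R m) ord_max) (@form_laplacian R m)
  (@form_ofD R m) (@form_ofZ R m) (@ext_d_form R m) (@codiff_form R m)
  (@interior_form R m) (@juhl_form R m) i a l v.
by split=> _ w [/form_ofP[v ->] _]; [exact: (model v).1 | exact: (model v).2].
Qed.
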